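(* There exists a universal constant $c>0$ such that the following holds. Let $n\ge 2$ and $t\ge 1$ be integers with $t\leq c\,\frac{n}{\log n}$. Let $F,G\subset S_n$ be families of permutations of $[n]$ such that for all $\sigma\in F$ and $\tau\in G$, $|\{i\in[n]:\sigma(i)=\tau(i)\}|\neq t-1$. Then $|F||G|\leq \big((n-t)!\big)^2$.
   Context: $[n]=\{1,\ldots,n\}$ and $S_n$ is the set of all permutations of $[n]$. *)

(* Defs.v *)
From mathcomp Require Import all_boot all_order all_algebra all_fingroup.
From mathcomp Require Import reals exp.

Set Implicit Arguments.
Unset Strict Implicit.
Unset Printing Implicit Defensive.

(* The ground set [n] is represented by 'I_n = {0, ..., n-1}, and S_n by
   'S_n = {perm 'I_n}. *)
Definition agreement_set (n : nat) (sigma tau : 'S_n) : {set 'I_n} :=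
  [set i | sigma i == tau i].

(* Main.v *)
(* A family is called global at a partial permutation X if no larger partial
   permutation U raises its relative density, measured by |F(U)| / (n - |U|)!,
   by more than a factor (11/10)^(|U| - |X|); maximising the density discounted
   by (11/10)^|U| always produces such an X.  For two global families the number
   of agreements of a random pair of members has its first three factorial
   moments close to those of a Poisson(1) variable, so Bonferroni's inequality
   yields a pair agreeing only where it must.  Adding common cells one at a time
   and restoring globalness in between produces any larger number of agreements.
   Hence, if F and G avoid t - 1 agreements, all sites X, Y at which dense
   subfamilies of F, G are global satisfy |X :&: Y| >= t, they have O(t log n)
   cells, and they cover F and G up to a fraction n^(-3t) of S_n.

   Cross-t-intersecting systems S, E of such small sites are simplified from the
   top: after shrinking sites to inclusion-minimal ones, a spreadness argument
   shows that the largest sites contribute a negligible amount to |F||G|, and can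
   be dropped.  What remains is a single site Z of size t for both families.
   Then |F(Z)| and |G(Z)| have order (n - t)!, which makes F \ F(Z) tiny; but one
   member of F \ F(Z) already excludes (n - 2t)! permutations from G(Z). *)

Require Import Defs.
From mathcomp Require Import all_boot all_order all_algebra all_fingroup.
From mathcomp Require Import reals exp.
From mathcomp Require Import zify ring lra.

Set Implicit Arguments.
Unset Strict Implicit.
Unset Printing Implicit Defensive.

Import Order.TTheory GRing.Theory Num.Theory.
Local Open Scope ring_scope.

Lemma leq_card_bigcup (I T : finType) (P : pred I) (B : I -> {set T}) :
  (#|\bigcup_(i | P i) B i| <= \sum_(i | P i) #|B i|)%N.
Proof.
elim/big_rec2: _ => [|i m D _ leDm]; first by rewrite cards0.
by apply: leq_trans (leq_card_setU _ _) _; rewrite leq_add2l.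
Qed.

(** * Partial permutations *)

Section Graphs.
Variable n : nat.
Implicit Types (s u : 'S_n) (X Y U : {set 'I_n * 'I_n}) (F G : {set 'S_n}).

Definition graph s : {set 'I_n * 'I_n} := [set e | s e.1 == e.2].
(** A site may be any set of cells; one that is not a partial permutation simply has no
    extensions. *)
Definition extensions X : {set 'S_n} := [set s | X \subset graph s].

Lemma card_graph s : #|graph s| = n.
Proof.
have -> : graph s = [set (i, s i) | i : 'I_n].
  apply/setP=> -[i j]; rewrite inE /=; apply/eqP/imsetP => [<-|[k _ [-> ->]]//].
  by exists i.
by rewrite card_imset ?card_ord // => i j [].
Qed.

Lemma graph_inj : injective graph.
Proof.
move=> s u /setP eq_su; apply/permP=> i.
by have := eq_su (i, s i); rewrite !inE /= eqxx => /esym/eqP.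
Qed.

Lemma card_agreement_set s u : #|agreement_set s u| = #|graph s :&: graph u|.
Proof.
have -> : graph s :&: graph u = [set (i, s i) | i in agreement_set s u].
  apply/setP=> -[i j]; rewrite !inE /=; apply/andP/imsetP.
    by case=> /eqP<- /eqP eq_u; exists i; rewrite // inE eq_u.
  by case=> k; rewrite inE => /eqP eq_k [-> ->]; rewrite -eq_k eqxx.
by rewrite card_imset // => i j [].
Qed.

Lemma extensionsS X Y : X \subset Y -> extensions Y \subset extensions X.
Proof.
by move=> sXY; apply/subsetP=> s; rewrite !inE; apply: subset_trans.
Qed.

Lemma extensionsU X Y : extensions (X :|: Y) = extensions X :&: extensions Y.
Proof. by apply/setP=> s; rewrite !inE subUset. Qed.

Lemma extensions0 : extensions set0 = setT.
Proof. by apply/setP=> s; rewrite !inE sub0set. Qed.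

(** Pick a row that [X] leaves free: an extension sends it to one of the [n - #|X|] free columns.
    The base case includes [#|X| > n], where the subtraction truncates to 0. *)
Lemma card_extensions_le X : (#|extensions X| <= (n - #|X|)`!)%N.
Proof.
elim: {X}(n - #|X|)%N {-2}X (erefl (n - #|X|)%N) => [|m IHm] X def_m.
  rewrite def_m fact0; apply/card_le1_eqP => s u; rewrite !inE => sXs sXu.
  have full v : X \subset graph v -> X = graph v.
    by move=> sXv; apply/eqP; rewrite eqEcard sXv card_graph; lia.
  by apply: graph_inj; rewrite -(full s) // -(full u).
have [->|[s0]] := set_0Vmem (extensions X); first by rewrite cards0.
rewrite inE => sX0.
have ltXn : (#|X| < n)%N by lia.
have [i iNX] : exists i, (i, s0 i) \notin X.
  have : ~~ (graph s0 \subset X).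
    by apply/negP=> /subset_leq_card; rewrite card_graph; lia.
  case/subsetPn=> -[i j]; rewrite inE /= => /eqP<- ?; by exists i.
pose J : {set 'I_n} := ~: [set e.2 | e in X].
have cardJ : #|J| = m.+1.
  rewrite cardsCs setCK card_ord card_in_imset //.
  move=> [i1 j1] [i2 j2] /(subsetP sX0) + /(subsetP sX0); rewrite !inE /=.
  by move=> /eqP<- /eqP<- /perm_inj->.
have sub : extensions X \subset \bigcup_(j in J) extensions ((i, j) |: X).
  apply/subsetP=> s; rewrite inE => sXs; apply/bigcupP; exists (s i).
    rewrite inE; apply/imsetP=> -[[k l] klX /= def_l].
    have := subsetP sXs _ klX; rewrite inE /= -def_l => /eqP/perm_inj eq_ki.
    have := subsetP sX0 _ klX; rewrite inE /= eq_ki => /eqP eq_l.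
    by case/negP: iNX; rewrite eq_l -eq_ki.
  rewrite inE; apply/subsetP=> e; rewrite in_setU1 => /orP[/eqP->|/(subsetP sXs)//].
  by rewrite inE.
apply: (leq_trans (subset_leq_card sub)).
apply: (leq_trans (leq_card_bigcup _ _)).
rewrite def_m factS -cardJ -sum_nat_const; apply: leq_sum => j jJ.
have ijNX : (i, j) \notin X.
  by apply: contraL jJ => ijX; rewrite inE negbK; apply/imsetP; exists (i, j).
have def_m' : (n - #|(i, j) |: X|)%N = m by rewrite cardsU1 ijNX /= add1n subnS def_m.
by rewrite -[X in X`!]def_m'; apply: IHm.
Qed.

End Graphs.

(** * Global families *)

Section Global.
Variables (R : realFieldType) (A : R) (n : nat).
Hypothesis A_gt0 : 0 < A.
Implicit Types (X Y U : {set 'I_n * 'I_n}) (F G : {set 'S_n}).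

Definition score F X : R :=
  #|F :&: extensions X|%:R / ((n - #|X|)`!%:R * A ^+ #|X|).

Definition global F X := forall U, X \subset U -> score F U <= score F X.

Lemma weight_gt0 X : 0 < (n - #|X|)`!%:R * A ^+ #|X| :> R.
Proof. by rewrite mulr_gt0 ?exprn_gt0 ?ltr0n ?fact_gt0. Qed.

Lemma exists_global F X0 :
  exists X, [/\ X0 \subset X, global F X & score F X0 <= score F X].
Proof.
case: (@arg_maxP _ _ _ X0 (fun X => X0 \subset X) (score F)) => // X sX0X maxX.
exists X; split=> // [U sXU|]; last exact: maxX.
by apply: maxX; apply: subset_trans sXU.
Qed.

Lemma score_ge0 F X : 0 <= score F X.
Proof. by rewrite divr_ge0 ?ler0n // ltW ?weight_gt0. Qed.

Lemma score_gt0 F X : (0 < score F X) = (F :&: extensions X != set0).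
Proof.
by rewrite /score pmulr_lgt0 ?invr_gt0 ?weight_gt0 // ltr0n card_gt0.
Qed.

(** This is what bounds sites: a score of at least [q > 0] forces [A ^+ #|X| <= 1 / q]. *)
Lemma score_le1 F X : score F X * A ^+ #|X| <= 1.
Proof.
have An_gt0 : 0 < A ^+ #|X| by rewrite exprn_gt0.
rewrite /score -mulrA invfM -mulrA mulVf ?gt_eqF // mulr1.
rewrite ler_pdivrMr ?mul1r ?ltr0n ?fact_gt0 // ler_nat.
apply: leq_trans (card_extensions_le X).
by rewrite subset_leq_card // subsetIr.
Qed.

Lemma scoreE F X :
  #|F :&: extensions X|%:R = score F X * ((n - #|X|)`!%:R * A ^+ #|X|).
Proof. by rewrite divfK // gt_eqF ?weight_gt0. Qed.

(** Globalness as a probability bound: a random member of [F] above [X] contains [U] with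
    probability at most [A ^+ #|U|] times the inverse falling factorial, which is the probability
    for a uniform extension of [X] compatible with [U]. *)
Lemma global_card F X U : global F X -> [disjoint U & X] ->
  #|F :&: extensions (X :|: U)|%:R * ((n - #|X|) ^_ #|U|)%:R
    <= A ^+ #|U| * #|F :&: extensions X|%:R.
Proof.
move=> globX disUX.
have cardU : #|X :|: U| = (#|X| + #|U|)%N.
  by rewrite cardsU (disjoint_setI0 _) ?cards0 ?subn0 // disjoint_sym.
case: (leqP #|U| (n - #|X|)) => [leU|ltU]; last first.
  by rewrite ffact_small // mulr0 mulr_ge0 ?ler0n // exprn_ge0 // ltW.
have := globX _ (subsetUl X U).
rewrite [in score F X]/score ler_pdivlMr ?weight_gt0 // => leF.
apply: le_trans (ler_wpM2l (ltW (exprn_gt0 #|U| A_gt0)) leF).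
rewrite [in X in X <= _]scoreE cardU subnDA -(ffact_fact leU) natrM exprD.
rewrite le_eqVlt; apply/orP; left; apply/eqP; ring.
Qed.

Lemma global_card1 F X e : global F X -> e \notin X ->
  #|F :&: extensions (e |: X)|%:R * (n - #|X|)%:R
    <= A * #|F :&: extensions X|%:R.
Proof.
move=> globX eNX; have := @global_card F X [set e] globX.
by rewrite disjoints1 cards1 ffactn1 expr1 setUC => ->.
Qed.

End Global.

(** * Pairs with a prescribed number of agreements *)

Section DoubleCounting.
Variables (T : finType).
Implicit Types U W : {set T}.

Lemma sum_bin_card (I : finType) (D : {set I}) (H : I -> {set T}) k :
  (\sum_(s in D) 'C(#|H s|, k)
     = \sum_(U : {set T} | #|U| == k) #|[set s in D | U \subset H s]|)%N.
Proof.
transitivity (\sum_(s in D) \sum_(U : {set T} | #|U| == k) (U \subset H s))%N.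
  apply: eq_bigr => s _; rewrite -cards_draws -sum1_card big_mkcond /=.
  rewrite [RHS]big_mkcond; apply: eq_bigr => U _; rewrite inE andbC.
  by case: (#|U| == k); case: (U \subset H s).
rewrite exchange_big; apply: eq_bigr => U _ /=.
rewrite -sum1_card big_mkcond [RHS]big_mkcond; apply: eq_bigr => s _ /=.
by rewrite inE; case: (s \in D); case: (U \subset H s).
Qed.

(** Both sides count triples of [s], [v] and a [k]-set inside [H s] and [K v]. The left side is, up
    to normalisation, the [k]-th binomial moment of the intersection size. *)
Lemma sum_bin_cardI (I J : finType) (D : {set I}) (E : {set J})
    (H : I -> {set T}) (K : J -> {set T}) k :
  (\sum_(s in D) \sum_(v in E) 'C(#|H s :&: K v|, k)
     = \sum_(U : {set T} | #|U| == k)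
         #|[set s in D | U \subset H s]| * #|[set v in E | U \subset K v]|)%N.
Proof.
transitivity (\sum_(p in setX D E) 'C(#|H p.1 :&: K p.2|, k))%N.
  by rewrite pair_big_dep; apply: eq_bigl => -[s v]; rewrite in_setX.
rewrite (sum_bin_card _ (fun p : I * J => H p.1 :&: K p.2)).
apply: eq_bigr => U _; rewrite -cardsX; apply: eq_card => p.
by rewrite !inE subsetI andbACA.
Qed.

End DoubleCounting.

(* For k >= 1 this says 1 - k + C(k, 2) - C(k, 3) <= 0. *)
Lemma bonferroni3 k : (0 < k)%N -> (1 + 'C(k, 2) <= k + 'C(k, 3))%N.
Proof.
case: k => // k _; elim: k => // k IHk.
rewrite binS (binS _ 2) bin1.
have : (k <= 'C(k.+1, 2))%N by case: (k) => // m; rewrite binS bin1; lia.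
lia.
Qed.

(** * Members of a family that avoid a given set of cells *)

Section Avoiding.
Variable n : nat.
Implicit Types (X Y W : {set 'I_n * 'I_n}) (F G : {set 'S_n}).

Definition avoiding F X W : {set 'S_n} :=
  [set s in F :&: extensions X | graph s :&: W \subset X].

Lemma leq_card_avoiding F X W :
  (#|F :&: extensions X|
     <= #|avoiding F X W| + \sum_(e in W :\: X) #|F :&: extensions (e |: X)|)%N.
Proof.
apply: leq_trans (leq_add (leqnn _) (leq_card_bigcup _ _)).
apply: leq_trans (leq_card_setU _ _); apply: subset_leq_card.
apply/subsetP=> s sFX; rewrite in_setU inE sFX /=.
case: (boolP (_ \subset X)) => //= /subsetPn[e]; rewrite inE => /andP[es eW] eX.
apply/bigcupP; exists e; first by rewrite inE eX.
by rewrite extensionsU !inE sub1set es; move: sFX; rewrite !inE => /andP[-> ->].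
Qed.

(** Union bound over the cells of [W :\: X], each of which lies in at most a fraction
    [A / (n - #|X|)] of the members by globalness. *)
Lemma card_avoiding (R : realFieldType) (A : R) F X W :
    0 < A -> global A F X ->
  #|F :&: extensions X|%:R * ((n - #|X|)%:R - A * #|W|%:R)
    <= #|avoiding F X W|%:R * (n - #|X|)%:R.
Proof.
move=> A0 globX; rewrite mulrBr lerBlDr.
have /ler_wpM2r : 0 <= (n - #|X|)%:R :> R by rewrite ler0n.
have := leq_card_avoiding F X W; rewrite -(ler_nat R) natrD => /[swap]/[apply].
rewrite mulrDl => /le_trans; apply; rewrite lerD2l.
rewrite natr_sum mulr_suml.
apply: (@le_trans _ _ (\sum_(e in W :\: X) A * #|F :&: extensions X|%:R)).
  by apply: ler_sum => e; rewrite inE => /andP[eX _]; apply: global_card1.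
rewrite sumr_const -[leLHS]mulr_natr mulrCA -mulrA.
rewrite ler_wpM2l ?(ltW A0) // ler_wpM2l ?ler0n // ler_nat subset_leq_card //.
exact: subsetDl.
Qed.

End Avoiding.

(** * Numerical bounds for the first three binomial moments *)

Section MomentBounds.
Variable R : realFieldType.
Local Notation A := (11 / 10 : R).

(** In the moment bounds [N] stands for [n], [f] and [g] for the sizes of the families above their
    sites, [f0] and [g0] for their avoiding parts, and [S] for the moment. The constant 1.103
    exceeds [A * 1000 / 999]. *)
Lemma moment1_bound (N a b f g g0 S : R) :
    0 < f -> 0 < g -> g0 <= g -> 0 < N -> 999 * N <= 1000 * a ->
    0 <= b -> b <= N -> a * S <= A * f * (g0 * b) ->
  S <= 1103 / 1000 * (f * g).
Proof.
move=> f0 g0' lg N0 la b0 lb leS.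
have a0 : 0 < a by lra.
rewrite -(ler_pM2l a0); apply: le_trans leS _.
have h1 : f * (g0 * b) <= f * (g * N) by rewrite ler_pM2l //; nra.
have h2 : f * g * (999 * N) <= f * g * (1000 * a) by rewrite ler_pM2l // mulr_gt0.
have h3 : 0 < f * g * N by rewrite !mulr_gt0.
lra.
Qed.

Lemma falling3_lower (N a : R) : 1000 <= N -> 999 * N <= 1000 * a ->
  994 / 1000 * N ^+ 3 <= a * (a - 1) * (a - 2).
Proof.
move=> N0 la.
have h0 : 999 / 1000 * N <= a by lra.
have h1 : 998 / 1000 * N <= a - 1 by lra.
have h2 : 997 / 1000 * N <= a - 2 by lra.
have p0 : 0 <= 999 / 1000 * N by lra.
have p1 : 0 <= 998 / 1000 * N by lra.
have p2 : 0 <= 997 / 1000 * N by lra.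
apply: le_trans (ler_pM (mulr_ge0 p0 p1) p2 (ler_pM p0 p1 h0 h1) h2).
have N3 : 0 <= N ^+ 3 by rewrite exprn_ge0; lra.
clear -N3; lra.
Qed.

Lemma falling2_lower (N a : R) : 1000 <= N -> 999 * N <= 1000 * a ->
  997 / 1000 * N ^+ 2 <= a * (a - 1).
Proof.
move=> N0 la.
have h0 : 999 / 1000 * N <= a by lra.
have h1 : 998 / 1000 * N <= a - 1 by lra.
have p0 : 0 <= 999 / 1000 * N by lra.
have p1 : 0 <= 998 / 1000 * N by lra.
apply: le_trans (ler_pM p0 p1 h0 h1).
have N2 : 0 <= N ^+ 2 by rewrite exprn_ge0; lra.
clear -N2; lra.
Qed.

Lemma moment3_bound (N a3 b3 f g g0 S : R) :
    0 < f -> 0 < g -> 0 <= g0 -> g0 <= g -> 0 < N ->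
    994 / 1000 * N ^+ 3 <= a3 -> 0 <= b3 -> b3 <= N ^+ 3 ->
    a3 * S <= A ^+ 3 * f * (g0 * (b3 / 6)) ->
  S <= 224 / 1000 * (f * g).
Proof.
move=> f0 g0' pg lg N0 la b0 lb leS.
have N3 : 0 < N ^+ 3 by rewrite exprn_gt0.
have a30 : 0 < a3 by lra.
rewrite -(ler_pM2l a30); apply: le_trans leS _.
have fg : 0 < f * g by rewrite mulr_gt0.
have h3 : f * (g0 * b3) <= f * (g * N ^+ 3).
  by rewrite ler_pM2l // ler_pM.
have h4 : f * g * (994 / 1000 * N ^+ 3) <= f * g * a3.
  by rewrite ler_pM2l.
have h5 : 0 < f * g * N ^+ 3 by rewrite mulr_gt0.
clear -h3 h4 h5; lra.
Qed.

(** Here [p] and [q] are the falling factorials of length 2. In units of [f * g] the bound obtained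
    is [0.998 * A ^+ 2 - A ^+ 4 / (2 * 0.997 ^+ 2)], slightly above 0.47. *)
Lemma moment2_bound (N p q f g f0 g0 S : R) :
    0 < f -> 0 < g -> 998 * f <= 1000 * f0 -> 998 * g <= 1000 * g0 -> 0 < N ->
    997 / 1000 * N ^+ 2 <= p -> 997 / 1000 * N ^+ 2 <= q ->
    A ^+ 2 * f * q * (g0 * (q / 2)) + A ^+ 2 * g * p * (f0 * (p / 2))
      <= A ^+ 4 * (f * g) * (N ^+ 4 / 2) + p * q * S ->
  47 / 100 * (f * g) <= S.
Proof.
move=> fp gp lf lg N0 lp lq leS.
have N2 : 0 < N ^+ 2 by rewrite exprn_gt0.
have p0 : 0 < p by clear -N2 lp; lra.
have q0 : 0 < q by clear -N2 lq; lra.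
have pq0 : 0 < p * q by rewrite mulr_gt0.
have fg : 0 < f * g by rewrite mulr_gt0.
rewrite -(ler_pM2l pq0).
have N4 : (997 / 1000) ^+ 2 * N ^+ 4 <= p * q.
  have -> : (997 / 1000) ^+ 2 * N ^+ 4 = (997 / 1000 * N ^+ 2) * (997 / 1000 * N ^+ 2) by ring.
  by apply: ler_pM => //; clear -N2; lra.
have h1 : f * g * ((997 / 1000) ^+ 2 * N ^+ 4) <= f * g * (p * q) by rewrite ler_pM2l.
have h2 : 998 * (g * f) * q ^+ 2 <= 1000 * (g0 * f) * q ^+ 2.
  by rewrite ler_pM2r ?exprn_gt0 // !mulrA ler_pM2r.
have h3 : 998 * (f * g) * p ^+ 2 <= 1000 * (f0 * g) * p ^+ 2.
  by rewrite ler_pM2r ?exprn_gt0 // !mulrA ler_pM2r.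
(* The two terms on the left of [leS] carry [q ^+ 2] and [p ^+ 2]; the arithmetic-geometric mean
   inequality turns them into the common factor [p * q]. *)
have h4 : f * g * (2 * (p * q)) <= f * g * (p ^+ 2 + q ^+ 2).
  rewrite ler_pM2l // -subr_ge0.
  have -> : p ^+ 2 + q ^+ 2 - 2 * (p * q) = (p - q) ^+ 2 by ring.
  exact: sqr_ge0.
have h5 : 0 < f * g * (p * q) by rewrite mulr_gt0.
clear -leS h1 h2 h3 h4 h5; lra.
Qed.

End MomentBounds.

(** * Pairs that agree exactly on the common cells of their sites *)

Section ExactAgreement.
Variables (R : realFieldType) (n : nat).
Local Notation A := (11 / 10 : R).
Implicit Types (X Y W U : {set 'I_n * 'I_n}) (F G : {set 'S_n}).

Lemma A_gt0 : 0 < A. Proof. by rewrite divr_gt0 ?ltr0n. Qed.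
#[local] Hint Resolve A_gt0 : core.

Definition small X := (#|X| * 1000 <= n)%N.

Lemma small_compl X : (1000 <= n)%N -> small X ->
  [/\ 1000 <= n%:R :> R, 999 * n%:R <= 1000 * (n - #|X|)%:R :> R,
     (n - #|X|)%:R <= n%:R :> R & 1000 * #|X|%:R <= n%:R :> R].
Proof.
rewrite /small => n1000 sX; rewrite -!natrM !ler_nat leq_subr n1000.
by split => //; lia.
Qed.

Lemma natr_ffact2 m : (2 <= m)%N -> (m ^_ 2)%:R = m%:R * (m%:R - 1) :> R.
Proof.
by move=> m2; rewrite 2!ffactnS ffactn0 muln1 natrM -subn1 natrB // ltnW.
Qed.

Lemma small_compl_ge3 X : (1000 <= n)%N -> small X -> (3 <= n - #|X|)%N.
Proof. by rewrite /small; lia. Qed.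

Lemma card_avoiding_ge F X W : (1000 <= n)%N -> small X -> small W ->
  global A F X -> 998 * #|F :&: extensions X|%:R <= 1000 * #|avoiding F X W|%:R :> R.
Proof.
move=> n1000 sX sW globX; have := card_avoiding W A_gt0 globX.
have [hN ha hle _] := small_compl n1000 sX.
have [_ _ _ hw] := small_compl n1000 sW.
move: hN ha hle hw.
set f := #|_ :&: _|%:R; set f0 := #|avoiding _ _ _|%:R; set a := (n - _)%:R.
set N := n%:R; set w := #|W|%:R => hN ha hle hw leF.
have f_ge0 : 0 <= f by rewrite ler0n.
have a_gt0 : 0 < a by lra.
rewrite -(ler_pM2r a_gt0).
suff : 998 * f * a <= 1000 * (f * (a - A * w)) by lra.
have : f * (2 * a) >= f * (1000 * (A * w)) by rewrite ler_wpM2l //; lra.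
clear; lra.
Qed.

(** What remains of [graph s] outside both sites has the same size for all avoiding members, so sums
    of its binomial coefficients are exact. *)
Lemma card_diff_avoiding F X W s : s \in avoiding F X W ->
  graph s :&: (X :|: W) = X /\ #|graph s :\: (X :|: W)| = (n - #|X|)%N.
Proof.
rewrite !inE => /andP[/andP[_ sXs] sWX].
have eqX : graph s :&: (X :|: W) = X.
  by rewrite setIUr (setIidPr sXs); apply/setUidPl.
by rewrite cardsD eqX card_graph.
Qed.

Lemma card_avoiding_sub F X W U : global A F X ->
  #|[set s in avoiding F X W | U \subset graph s :\: (X :|: W)]|%:R
     * ((n - #|X|) ^_ #|U|)%:R <= A ^+ #|U| * #|F :&: extensions X|%:R.
Proof.
move=> globX; case: (boolP [disjoint U & X]) => [disUX|ndis].
  apply: le_trans (global_card A_gt0 globX disUX).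
  rewrite ler_wpM2r ?ler0n // ler_nat subset_leq_card //.
  apply/subsetP=> s; rewrite !inE => /andP[/andP[/andP[-> sXs] _] sUs].
  by rewrite subUset sXs (subset_trans sUs) ?subsetDl.
rewrite (_ : [set s in _ | _] = set0) ?cards0 ?mul0r.
  by rewrite mulr_ge0 ?exprn_ge0 ?ler0n // ltW.
apply/setP=> s; rewrite !inE; apply: contraNF ndis => /andP[_ sUs].
rewrite -setI_eq0 -subset0; apply/subsetP=> e; rewrite inE => /andP[/(subsetP sUs)].
by rewrite !inE => /andP[/norP[/negbTE->]].
Qed.

(** Members avoiding the other site meet [X :|: Y] in exactly [X], respectively [Y]. If their
    remainders [H s] and [H u] always intersected, Bonferroni's inequality summed over all pairs
    would contradict the moment estimates. *)
Lemma exists_graphI F G X Y : (1000 <= n)%N -> small X -> small Y ->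
  global A F X -> global A G Y ->
  F :&: extensions X != set0 -> G :&: extensions Y != set0 ->
  exists s u, [/\ s \in F, u \in G & graph s :&: graph u = X :&: Y].
Proof.
move=> n1000 sX sY globX globY neF neG.
pose F0 := avoiding F X Y; pose G0 := avoiding G Y X.
pose H s := graph s :\: (X :|: Y).
have HF s : s \in F0 -> graph s :&: (X :|: Y) = X /\ #|H s| = (n - #|X|)%N.
  exact: card_diff_avoiding.
have HG s : s \in G0 -> graph s :&: (X :|: Y) = Y /\ #|H s| = (n - #|Y|)%N.
  by rewrite /H setUC; apply: card_diff_avoiding.
case: (boolP [exists s in F0, exists u in G0, H s :&: H u == set0]).
  case/existsP=> s /andP[sF0 /existsP[u /andP[uG0 /eqP dis]]].
  exists s, u; split.
  - by move: sF0; rewrite !inE => /andP[/andP[]].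
  - by move: uG0; rewrite !inE => /andP[/andP[]].
  have [/setP eqX _] := HF _ sF0; have [/setP eqY _] := HG _ uG0.
  apply/setP=> e; move/setP/(_ e): dis; move: (eqX e) (eqY e); rewrite !inE.
  by case: (e \in X); case: (e \in Y); case: (s _ == _); case: (u _ == _).
move/existsPn=> noF.
have N_gt0 s u : s \in F0 -> u \in G0 -> (0 < #|H s :&: H u|)%N.
  move=> sF0 uG0; rewrite card_gt0; have := noF s; rewrite sF0 /= => /existsPn/(_ u).
  by rewrite uG0.
pose S k := (\sum_(s in F0) \sum_(u in G0) 'C(#|H s :&: H u|, k))%N.
have S0 : S 0%N = (#|F0| * #|G0|)%N.
  rewrite /S; under eq_bigr do under eq_bigr do rewrite bin0.
  by rewrite !sum_nat_const muln1.
have leS : (S 0 + S 2 <= S 1 + S 3)%N.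
  rewrite /S -!big_split; apply: leq_sum => s sF0 /=.
  rewrite -!big_split; apply: leq_sum => u uG0 /=.
  by rewrite bin0 bin1; apply: bonferroni3; apply: N_gt0.
pose p U := #|[set s in F0 | U \subset H s]|.
pose q U := #|[set s in G0 | U \subset H s]|.
have SE k : S k = (\sum_(U : {set 'I_n * 'I_n} | #|U| == k) p U * q U)%N by apply: sum_bin_cardI.
have sum_p k : (\sum_(U : {set 'I_n * 'I_n} | #|U| == k) p U = #|F0| * 'C(n - #|X|, k))%N.
  rewrite -(sum_bin_card F0 H) -sum_nat_const; apply: eq_bigr => s sF0.
  by have [_ ->] := HF s sF0.
have sum_q k : (\sum_(U : {set 'I_n * 'I_n} | #|U| == k) q U = #|G0| * 'C(n - #|Y|, k))%N.
  rewrite -(sum_bin_card G0 H) -sum_nat_const; apply: eq_bigr => s sG0.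
  by have [_ ->] := HG s sG0.
set f := #|F :&: extensions X|; set g := #|G :&: extensions Y|.
have le_p U : (p U)%:R * ((n - #|X|) ^_ #|U|)%:R <= A ^+ #|U| * f%:R.
  exact: card_avoiding_sub.
have le_q U : (q U)%:R * ((n - #|Y|) ^_ #|U|)%:R <= A ^+ #|U| * g%:R.
  by rewrite /q /H setUC; apply: card_avoiding_sub.
(* Globalness bounds each factor [p U], while the factors [q U] are summed exactly by [sum_q]. *)
have upper k : ((n - #|X|) ^_ k)%:R * (S k)%:R
    <= A ^+ k * f%:R * (#|G0|%:R * ('C(n - #|Y|, k))%:R).
  rewrite SE -(natrM _ #|G0|) -sum_q !natr_sum !mulr_sumr; apply: ler_sum => U /eqP cardU.
  rewrite natrM mulrA ler_wpM2r ?ler0n // mulrC -{1}cardU.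
  by apply: le_trans (le_p U) _; rewrite cardU.
have lower : A ^+ 2 * f%:R * ((n - #|Y|) ^_ 2)%:R * (#|G0|%:R * ('C(n - #|Y|, 2))%:R)
   + A ^+ 2 * g%:R * ((n - #|X|) ^_ 2)%:R * (#|F0|%:R * ('C(n - #|X|, 2))%:R)
   <= A ^+ 4 * (f%:R * g%:R) * ('C(n * n, 2))%:R
      + ((n - #|X|) ^_ 2)%:R * ((n - #|Y|) ^_ 2)%:R * (S 2)%:R.
  rewrite -(natrM _ #|G0|) -(natrM _ #|F0|) -sum_p -sum_q SE !natr_sum !mulr_sumr.
  (* This counts all 2-sets of cells, each contributing the constant term of the product of the two
     defects. *)
  have -> : ('C(n * n, 2))%:R = \sum_(U : {set 'I_n * 'I_n} | #|U| == 2%N) 1 :> R.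
    have -> : (n * n)%N = #|{: 'I_n * 'I_n}| by rewrite card_prod card_ord.
    by rewrite -card_draws -sum1_card natr_sum; apply: eq_bigl => U; rewrite inE.
  rewrite mulr_sumr -!big_split; apply: ler_sum => U /eqP cardU /=.
  have := le_p U; have := le_q U; rewrite cardU natrM.
  move: ((n - #|X|) ^_ 2)%:R ((n - #|Y|) ^_ 2)%:R (p U)%:R (q U)%:R f%:R g%:R.
  move=> a b x y f' g' hq hp.
  (* both factors are upper-bound defects, hence nonnegative: this turns the
     globalness upper bounds into a lower bound on the second moment *)
  have h : 0 <= (A ^+ 2 * f' - x * a) * (A ^+ 2 * g' - y * b).
    by rewrite mulr_ge0 // subr_ge0.
  clear -h; rewrite -subr_ge0; apply: le_trans h _.
  by rewrite le_eqVlt; apply/orP; left; apply/eqP; ring.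
have binE m k : ('C(m, k))%:R = (m ^_ k)%:R / (k`!)%:R :> R.
  by rewrite -bin_ffact natrM mulfK // pnatr_eq0 -lt0n fact_gt0.
have ffact_leX m k : (m <= n)%N -> (m ^_ k)%:R <= n%:R ^+ k :> R.
  move=> le_mn; rewrite -natrX ler_nat.
  elim: k => // k IHk; rewrite ffactnSr expnSr leq_mul //.
  exact: leq_trans (leq_subr _ _) le_mn.
have ffact3 m : (3 <= m)%N -> (m ^_ 3)%:R = m%:R * (m%:R - 1) * (m%:R - 2) :> R.
  move=> m3; rewrite ffactnSr natrM natrB ?natr_ffact2 //; exact: ltnW.
have [hN ha hale _] := small_compl n1000 sX.
have [_ hb hble _] := small_compl n1000 sY.
have N_gt0' : 0 < n%:R :> R by apply: lt_le_trans hN; rewrite ltr0n.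
have a3 := small_compl_ge3 n1000 sX.
have b3 := small_compl_ge3 n1000 sY.
have f_gt0 : 0 < f%:R :> R by rewrite ltr0n card_gt0.
have g_gt0 : 0 < g%:R :> R by rewrite ltr0n card_gt0.
have le_F0 := card_avoiding_ge n1000 sX sY globX.
have le_G0 := card_avoiding_ge n1000 sY sX globY.
have le_gG : #|G0|%:R <= g%:R :> R.
  by rewrite ler_nat subset_leq_card //; apply/subsetP=> s; rewrite inE => /andP[].
have S1 : (S 1)%:R <= 1103 / 1000 * (f%:R * g%:R) :> R.
  have b_ge0 := ler0n R (n - #|Y|).
  apply: (moment1_bound f_gt0 g_gt0 le_gG N_gt0' ha b_ge0 hble).
  by have := upper 1%N; rewrite expr1 ffactn1 bin1.
have S3 : (S 3)%:R <= 224 / 1000 * (f%:R * g%:R) :> R.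
  apply: (moment3_bound f_gt0 g_gt0 (ler0n _ _) le_gG N_gt0' _ _ _ _).
  - by apply: (falling3_lower hN ha).
  - exact: (ler0n _ ((n - #|Y|) ^_ 3)).
  - by apply: ffact_leX; rewrite leq_subr.
  - by rewrite -ffact3 //; have := upper 3%N; rewrite binE.
have S2 : 47 / 100 * (f%:R * g%:R) <= (S 2)%:R :> R.
  apply: (moment2_bound f_gt0 g_gt0 le_F0 le_G0 N_gt0'
            (falling2_lower hN ha) (falling2_lower hN hb)).
  rewrite -!natr_ffact2 //; [|exact: ltnW..].
  move: lower; rewrite !binE (_ : 2`! = 2%N) // => /le_trans; apply; rewrite lerD2r.
  rewrite ler_wpM2l //.
    by apply: mulr_ge0; [apply: exprn_ge0; apply: ltW | apply: ltW; apply: mulr_gt0].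
  rewrite ler_wpM2r ?invr_ge0 ?ler0n // -natrX ler_nat.
  rewrite !ffactnS ffactn0 muln1 (expnD n 2 2) mulnn leq_mul //.
  exact: leq_pred.
(* In units of [f * g], the left side is at least 0.998^2 + 0.47 and the right side at most 1.103 +
   0.224. *)
have := leS; rewrite -(ler_nat R) !natrD S0 natrM leNgt => /negP[].
have : 998 * f%:R * (998 * g%:R) <= 1000 * #|F0|%:R * (1000 * #|G0|%:R) :> R.
  by rewrite ler_pM // mulr_ge0 // ler0n.
have : 0 < f%:R * g%:R :> R by rewrite mulr_gt0.
move: S1 S2 S3; clear; move: (f%:R) (g%:R) (#|F0|%:R) (#|G0|%:R).
move: (S 1)%:R (S 2)%:R (S 3)%:R => S1 S2 S3 f' g' f0 g0 h1 h2 h3 h4 h5; lra.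
Qed.

End ExactAgreement.

(** * Adding one common cell to a pair of global sites *)

Section ExtendAgreement.
Variables (R : realFieldType) (n : nat).
Local Notation A := (11 / 10 : R).
Implicit Types (X Y W U : {set 'I_n * 'I_n}) (F G : {set 'S_n}).
Hypothesis n1000 : (1000 <= n)%N.

Lemma popular_columns_bound (N a f k : R) : 0 < f -> 1000 <= N ->
    999 * N <= 1000 * a -> 0 <= k ->
    998 * f * a <= 1000 * (k * (A * f) + f / 4 * a) ->
  N < 2 * k.
Proof.
move=> f0 hN ha hk h.
have : f * (998 * a) <= f * (1100 * k + 250 * a) by lra.
by rewrite ler_pM2l // => {}h; lra.
Qed.

(** Unpopular columns account for at most a quarter of the family and each popular one for at most a
    fraction [A / (n - #|X|)], so about 0.68 [n] columns are popular. More than half is what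
    matters: two families then share a popular column. *)
Lemma popular_columns F X W i : small X -> small W -> global A F X ->
    F :&: extensions X != set0 -> (forall j, (i, j) \notin X) ->
  (n < 2 * #|[set j | (#|F :&: extensions X|
          <= 4 * n * #|avoiding F X W :&: extensions [set (i, j)]|)%N]|)%N.
Proof.
move=> sX sW globX neF iNX; set J := [set j | _].
have := card_avoiding_ge n1000 sX sW globX.
have [hN ha _ _] := small_compl R n1000 sX.
have f_gt0 : 0 < #|F :&: extensions X|%:R :> R by rewrite ltr0n card_gt0.
set f := #|_ :&: _| in f_gt0 *; set F0 := avoiding F X W => leF0.
pose x j := #|F0 :&: extensions [set (i, j)]|.
have sum_x : #|F0| = (\sum_j x j)%N.
  rewrite -sum1_card (partition_big (fun s : 'S_n => s i) xpredT) //=.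
  apply: eq_bigr => j _; rewrite sum1_card; apply: eq_card => s.
  by rewrite -topredE /= !inE sub1set inE.
have x_le j : (x j)%:R * (n - #|X|)%:R <= A * f%:R.
  apply: le_trans (global_card1 (A_gt0 R) globX (iNX j)).
  rewrite ler_wpM2r ?ler0n // ler_nat subset_leq_card // extensionsU.
  apply/subsetP=> s; rewrite 2!inE => /andP[/andP[/setIP[sF sX'] _] se].
  by rewrite !inE sF; move: sX' se; rewrite !inE => -> ->.
have a_gt0 : 0 < (n - #|X|)%:R :> R by lra.
rewrite -(ltr_nat R) natrM.
apply: (popular_columns_bound f_gt0 hN ha) => //.
apply: (le_trans (ler_wpM2r (ltW a_gt0) leF0)); rewrite -[leLHS]mulrA ler_wpM2l //.
rewrite sum_x natr_sum mulr_suml (bigID (mem J)) /=; apply: lerD.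
  rewrite [leRHS]mulrC [leRHS]mulr_natr -sumr_const; apply: ler_sum => j _; exact: x_le.
apply: (@le_trans _ _ (\sum_(j < n) f%:R / 4 / n%:R * (n - #|X|)%:R)).
  rewrite [leRHS](bigID (mem J)) /= -[leLHS]add0r; apply: lerD.
    by apply: sumr_ge0 => j _; rewrite !mulr_ge0 ?invr_ge0 ?ler0n.
  apply: ler_sum => j; rewrite inE -ltnNge => /ltnW.
  rewrite -(ler_nat R) !natrM ler_pM2r // => le_x.
  have N_gt0 : 0 < n%:R :> R by lra.
  by rewrite ler_pdivlMr // ler_pdivlMr //; move: le_x; rewrite /x; lra.
rewrite sumr_const card_ord -mulr_natr.
have N_neq0 : n%:R != 0 :> R by rewrite gt_eqF //; lra.
by rewrite le_eqVlt; apply/orP; left; apply/eqP; field.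
Qed.

(** The new cell multiplies the normalising weight by [A / (n - #|X|)], so the score drops by a
    factor of at most [8 * A * n / (n - #|X|) < 16]. *)
Lemma score_extend F F' X e : small X -> e \notin X ->
    (#|F :&: extensions X| <= 8 * n * #|F' :&: extensions (e |: X)|)%N ->
  score A F X <= 16 * score A F' (e |: X).
Proof.
move=> sX eX; rewrite -(ler_nat R) !natrM => leF.
have [hN ha hale _] := small_compl R n1000 sX.
have a3 := small_compl_ge3 n1000 sX.
rewrite /score ler_pdivrMr ?weight_gt0 ?A_gt0 // (le_trans leF) //.
rewrite cardsU1 eX /= [in (n - _)%N]add1n subnS.
have -> : (n - #|X|)`! = ((n - #|X|) * (n - #|X|).-1`!)%N.
  by case: (n - #|X|)%N a3 => // m _; rewrite factS.
rewrite natrM exprD expr1; set f := #|_ :&: _|%:R; set m := (_ .-1`!)%:R.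
have m_neq0 : m != 0 by rewrite pnatr_eq0 -lt0n fact_gt0.
have A_neq0 : A ^+ #|X| != 0 by rewrite expf_neq0 // gt_eqF ?A_gt0.
move: A_neq0; set Ax := A ^+ _ => Ax_neq0.
rewrite [leRHS](_ : _ = f * ((16 * 10 / 11) * (n - #|X|)%:R)); last first.
  by field; rewrite Ax_neq0.
by rewrite mulrC ler_wpM2l ?ler0n //; lra.
Qed.

Lemma pair_loss_bound (N b g w : R) : 0 < g -> 1000 <= N ->
    997 / 1000 * N ^+ 2 <= b -> 1000 * w <= N ->
  8 * N * (w * (A ^+ 2 * g)) <= g * b.
Proof.
move=> g0 hN hb hw.
have h1 : N * (8 * A ^+ 2 * w) <= N * (997 / 1000 * N).
  by rewrite ler_pM2l; lra.
have : g * (N * (8 * A ^+ 2 * w)) <= g * b.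
  rewrite ler_pM2l //; apply: le_trans h1 _; apply: le_trans hb.
  by rewrite le_eqVlt; apply/orP; left; apply/eqP; ring.
apply: le_trans; rewrite le_eqVlt; apply/orP; left; apply/eqP; ring.
Qed.

Lemma half_loss k g z v l : (g <= 4 * k * z)%N -> (z <= v + l)%N ->
  (8 * k * l <= g)%N -> (g <= 8 * k * v)%N.
Proof.
move=> le_gz le_zv le_lg.
have := leq_mul (leqnn (8 * k)) le_zv.
have -> : (8 * k * z = 4 * k * z + 4 * k * z)%N by lia.
rewrite mulnDr; move: le_gz le_lg.
by move: (4 * k * z)%N (8 * k * l)%N (8 * k * v)%N => *; lia.
Qed.

(** Globalness is known at [Y], not at [e |: Y], so the loss at a cell [z] of [W] is bounded through
    the pair [[set z; e]]. The total loss is of order [#|W| / n ^ 2], less than half of the fraction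
    [1 / (4 * n)] available above [e |: Y]. *)
Lemma card_avoiding_extend G Y e W : small Y -> small W -> global A G Y ->
    e \notin Y -> G :&: extensions Y != set0 ->
    (#|G :&: extensions Y| <= 4 * n * #|G :&: extensions (e |: Y)|)%N ->
  (#|G :&: extensions Y| <= 8 * n * #|avoiding G (e |: Y) W|)%N.
Proof.
move=> sY sW globY eY neG le4.
have := leq_card_avoiding G (e |: Y) W.
have [hN hb _ _] := small_compl R n1000 sY.
have [_ _ _ hw] := small_compl R n1000 sW.
have b3 := small_compl_ge3 n1000 sY.
have b2 := natr_ffact2 R (ltnW b3).
have lb2 := falling2_lower hN hb; rewrite -b2 in lb2.
set g := #|_ :&: _| in le4 *.
have g_gt0 : 0 < g%:R :> R by rewrite ltr0n card_gt0.
move=> leG.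
set L := (\sum_(_ in _) _)%N in leG.
apply: (half_loss le4 leG).
rewrite -(ler_nat R) !natrM.
have b_gt0 : 0 < ((n - #|Y|) ^_ 2)%:R :> R.
  by rewrite ltr0n ffact_gt0; apply: ltnW.
rewrite -(ler_pM2r b_gt0); apply: le_trans (pair_loss_bound g_gt0 hN lb2 hw).
rewrite -[leLHS]mulrA ler_wpM2l ?mulr_ge0 ?ler0n //.
rewrite natr_sum mulr_suml.
apply: (@le_trans _ _ (\sum_(z in W :\: (e |: Y)) A ^+ 2 * g%:R)).
  apply: ler_sum => z; rewrite !inE => /andP[/norP[ze zY] _].
  have := @global_card _ A _ (A_gt0 R) G Y [set z; e] globY.
  rewrite cards2 ze (_ : Y :|: _ = z |: (e |: Y)); last by rewrite setUC setUA.
  apply.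
  by rewrite disjoints_subset subUset !sub1set !inE zY eY.
rewrite sumr_const -[leLHS]mulr_natl ler_wpM2r //.
  by rewrite mulr_ge0 ?ler0n // exprn_ge0 // ltW ?A_gt0.
by rewrite ler_nat subset_leq_card // subsetDl.
Qed.

(** A cell [e] popular for both families is added to both sites. First [F] is made to avoid [Y] and
    globalness is restored at [X']; only then is [G] made to avoid [X']. Restoring globalness thus
    creates no common cell besides [e]. *)
Lemma extend_agreement F G X Y : small X -> small Y ->
    global A F X -> global A G Y ->
    F :&: extensions X != set0 -> G :&: extensions Y != set0 ->
    (forall F' X', score A F X <= 16 * score A F' X' -> small X') ->
  exists F' G' X' Y',
    [/\ F' \subset F, G' \subset G, global A F' X', global A G' Y' &
     [/\ #|X' :&: Y'| = #|X :&: Y|.+1,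
         score A F X <= 16 * score A F' X' &
         score A G Y <= 16 * score A G' Y']].
Proof.
move=> sX sY globX globY neF neG small_scores.
have [i [iX iY]] : exists i, (forall j, (i, j) \notin X) /\ (forall j, (i, j) \notin Y).
  pose rows := [set z.1 | z in X :|: Y].
  have : (#|rows| < n)%N.
    apply: leq_ltn_trans (leq_imset_card _ _) _.
    apply: leq_ltn_trans (leq_card_setU _ _) _.
    rewrite -(ltn_pmul2r (isT : 0 < 1000)%N) mulnDl.
    by apply: leq_ltn_trans (leq_add sX sY) _; move: n1000; clear; lia.
  rewrite -[X in (_ < X)%N]card_ord -cardsT => lt_rows.
  have : ~~ ([set: 'I_n] \subset rows).
    by apply/negP=> /subset_leq_card; rewrite leqNgt lt_rows.
  case/subsetPn=> i _ iNr; exists i.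
  by split=> j; apply: contra iNr => ijX; apply/imsetP; exists (i, j) => //;
     rewrite inE ijX ?orbT.
have popF := popular_columns sX sY globX neF iX.
have popG := popular_columns sY sX globY neG iY.
set JF := [set j | _] in popF; set JG := [set j | _] in popG.
have [j] : exists j, j \in JF :&: JG.
  apply/set0Pn; rewrite -card_gt0.
  have := cardsUI JF JG; have := max_card (JF :|: JG); rewrite card_ord.
  by move: popF popG; clear; lia.
rewrite !inE => /andP[popFj popGj].
pose e := (i, j).
have eX : e \notin X by apply: iX.
have eY : e \notin Y by apply: iY.
pose F' := avoiding F X Y.
have sF'F : F' \subset F by apply/subsetP=> s; rewrite !inE -!andbA => /andP[].
have extF' Z : F' :&: extensions (Z :|: X) = F' :&: extensions Z.
  apply/setP=> s; rewrite extensionsU !inE.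
  by case: (s \in F); case: (X \subset _); rewrite ?andbT ?andbF.
have score0 : score A F X <= 16 * score A F' (e |: X).
  apply: score_extend => //; rewrite extF'; apply: leq_trans popFj _.
  by rewrite !leq_mul2r !orbT.
have [X' [seX' globX' scoreX']] := exists_global A F' (e |: X).
have scoreF : score A F X <= 16 * score A F' X'.
  by apply: le_trans score0 _; rewrite ler_pM2l // ltr0n.
have sX' := small_scores _ _ scoreF.
have scoreF_gt0 : 0 < score A F X by rewrite score_gt0 ?A_gt0.
(* A positive score provides a member of [F'] containing [X'], and that member meets [Y] only inside
   [X]. *)
have X'Y : X' :&: Y \subset X.
  have : 0 < score A F' X'
    by rewrite -(pmulr_rgt0 _ (_ : 0 < 16)) ?ltr0n // (lt_le_trans scoreF_gt0).
  rewrite score_gt0 ?A_gt0 // => /set0Pn[s]; rewrite !inE.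
  case/andP=> /andP[_ sYX] X's; apply: subset_trans sYX; exact: setSI.
pose G' := avoiding G (e |: Y) X'.
have leG' : (#|G :&: extensions Y| <= 8 * n * #|G'|)%N.
  apply: card_avoiding_extend => //; apply: leq_trans popGj _.
  rewrite leq_mul2l; apply/orP; right; rewrite subset_leq_card //.
  apply/subsetP=> s /setIP[]; rewrite inE => /andP[/setIP[sG sY'] _] se.
  by rewrite extensionsU !in_setI sG sY' se.
have sG'G : G' \subset G by apply/subsetP=> s; rewrite !inE -!andbA => /andP[].
have scoreG0 : score A G Y <= 16 * score A G' (e |: Y).
  apply: score_extend => //; rewrite (_ : G' :&: _ = G') //; apply/setIidPl.
  by apply/subsetP=> s; rewrite inE => /andP[/setIP[]].
have [Y' [seY' globY' scoreY']] := exists_global A G' (e |: Y).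
have scoreG : score A G Y <= 16 * score A G' Y'.
  by apply: le_trans scoreG0 _; rewrite ler_pM2l // ltr0n.
have scoreG_gt0 : 0 < score A G Y by rewrite score_gt0 ?A_gt0.
have Y'X' : X' :&: Y' \subset e |: Y.
  have : 0 < score A G' Y'
    by rewrite -(pmulr_rgt0 _ (_ : 0 < 16)) ?ltr0n // (lt_le_trans scoreG_gt0).
  rewrite score_gt0 ?A_gt0 // => /set0Pn[s]; rewrite !inE.
  case/andP=> /andP[_ sXY] Y's; apply: subset_trans sXY; rewrite setIC; exact: setSI.
exists F', G', X', Y'; split=> //; split=> //.
suff -> : X' :&: Y' = e |: (X :&: Y) by rewrite cardsU1 !inE (negbTE eX).
apply/eqP; rewrite eqEsubset; apply/andP; split; apply/subsetP=> z.
  move=> zXY; have := subsetP Y'X' _ zXY; rewrite !inE => /orP[->//|zY].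
  have /(subsetP X'Y) -> : z \in X' :&: Y by move: zXY; rewrite !inE zY => /andP[->].
  by rewrite zY orbT.
rewrite !inE => zXY; apply/andP; split.
  apply: (subsetP seX'); rewrite !inE; by case/orP: zXY => [->|/andP[->]]; rewrite ?orbT.
apply: (subsetP seY'); rewrite !inE; by case/orP: zXY => [->|/andP[_ ->]]; rewrite ?orbT.
Qed.

End ExtendAgreement.

(** * Reaching a prescribed number of agreements *)

Section RealizeAgreement.
Variables (R : realFieldType) (n : nat).
Local Notation A := (11 / 10 : R).
Implicit Types (X Y : {set 'I_n * 'I_n}) (F G : {set 'S_n}).

(** Each added cell costs a factor 16 in score, so the induction replaces [p] by [p / 16]; the
    hypothesis on [16 ^+ k] keeps every site met on the way small. *)
Lemma exists_agreement_card k p F G X Y : (1000 <= n)%N -> 0 < p ->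
    (forall F' X', p <= 16 ^+ k * score A F' X' -> small X') ->
    global A F X -> global A G Y -> p <= score A F X -> p <= score A G Y ->
  exists s u, [/\ s \in F, u \in G & #|graph s :&: graph u| = (#|X :&: Y| + k)%N].
Proof.
move=> n1000; have pow16 m : 1 <= 16 ^+ m :> R by rewrite exprn_ege1 // ler1n.
have score_nonneg F' X' : 0 <= score A F' X' by rewrite score_ge0 ?A_gt0.
elim: k p F G X Y => [|k IHk] p F G X Y p0 sm globX globY pX pY.
all: have sX : small X by apply: (sm F); apply: le_trans pX _; apply: ler_peMl.
all: have sY : small Y by apply: (sm G); apply: le_trans pY _; apply: ler_peMl.
all: have neF : F :&: extensions X != set0
  by rewrite -(score_gt0 (A_gt0 R)) (lt_le_trans p0).
all: have neG : G :&: extensions Y != set0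
  by rewrite -(score_gt0 (A_gt0 R)) (lt_le_trans p0).
  have [s [u [sF uG eq_su]]] := exists_graphI n1000 sX sY globX globY neF neG.
  by exists s, u; split=> //; rewrite eq_su addn0.
have [|F' [G' [X' [Y' [sF' sG' globX' globY' [card' leF' leG']]]]]] :=
    extend_agreement n1000 sX sY globX globY neF neG.
  move=> F' X' le16; apply: (sm F'); apply: le_trans pX _; apply: le_trans le16 _.
  by rewrite exprS -mulrA ler_pM2l ?ltr0n // ler_peMl.
have [] := IHk (p / 16) F' G' X' Y'; rewrite ?divr_gt0 ?ltr0n //.
- move=> F2 X2; rewrite ler_pdivrMr ?ltr0n // mulrAC -exprSr; exact: sm.
- by rewrite ler_pdivrMr ?ltr0n // mulrC (le_trans pX).
- by rewrite ler_pdivrMr ?ltr0n // mulrC (le_trans pY).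
move=> s [u [sF uG eq_su]]; exists s, u; split; first exact: (subsetP sF').
  exact: (subsetP sG').
by rewrite eq_su card' addSnnS.
Qed.

End RealizeAgreement.

(** * Cross-intersecting systems of small sites *)

Section Minimal.
Variable T : finType.
Implicit Types (X Y Z V : {set T}) (S E : {set {set T}}).

Definition cross_intersecting t S E :=
  forall X Y, X \in S -> Y \in E -> (t <= #|X :&: Y|)%N.

(** The subsets [X'] need not belong to [S]: no member can be shrunk at all without meeting some
    member of [E] in fewer than [t] points. *)
Definition minimal_for t S E := forall X X', X \in S -> X' \proper X ->
  exists2 Y, Y \in E & (#|X' :&: Y| < t)%N.

Lemma leq_bin_expS b j : ('C(b + j, j) <= b.+1 ^ j)%N.
Proof.
elim: j => [|j IHj]; first by rewrite bin0.
rewrite -(leq_pmul2l (ltn0Sn j)) addnS -mul_bin_diag expnS.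
rewrite mulnA leq_mul //; lia.
Qed.

Variable R : realFieldType.

(* Take Z maximising the weight above Z times (b + 2)^|Z|.  If some Y in E met Z
   in t - j < t points, all members above Z would contain one of at most
   C(b + j, j) < (b + 2)^j further j-sets, contradicting the choice of Z; so Z
   meets all of E and minimality makes it the only member above Z. *)
Lemma sum_minimal_above t b (lam : R) S E V : 0 < lam ->
    cross_intersecting t S E -> minimal_for t S E ->
    (forall Y, Y \in E -> (#|Y| <= t + b)%N) ->
    0 < \sum_(X in S | V \subset X) lam ^+ #|X| ->
  exists2 Z, (Z \in S) && (V \subset Z) &
    (\sum_(X in S | V \subset X) lam ^+ #|X|) * b.+2%:R ^+ #|V|
       <= (lam * b.+2%:R) ^+ #|Z|.
Proof.
move=> lam0 cross minS sizeE sumV.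
pose w Z := \sum_(X in S | Z \subset X) lam ^+ #|X|.
pose r : R := b.+2%:R.
have r0 : 0 < r by rewrite ltr0n.
case: (@arg_maxP _ _ _ V (fun Z => V \subset Z) (fun Z => w Z * r ^+ #|Z|)) => // Z sVZ max_Z.
have maxZ (U : {set T}) : V \subset U -> w U * r ^+ #|U| <= w Z * r ^+ #|Z| by move/max_Z.
have w_ge0 U : 0 <= w U by apply: sumr_ge0 => X _; rewrite exprn_ge0 // ltW.
have wZ0 : 0 < w Z.
  rewrite -(pmulr_lgt0 _ (exprn_gt0 #|Z| r0)).
  apply: lt_le_trans (maxZ V (subxx V)); rewrite mulr_gt0 ?exprn_gt0 //.
have capZ Y : Y \in E -> (t <= #|Z :&: Y|)%N.
  move=> YE; rewrite leqNgt; apply/negP=> ltZY.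
  pose j := (t - #|Z :&: Y|)%N.
  have j0 : (0 < j)%N by rewrite subn_gt0.
  have wZ_le : w Z <= \sum_(U : {set T} | (U \subset Y :\: Z) && (#|U| == j)) w (Z :|: U).
    rewrite /w (exchange_big_dep (fun X => (X \in S) && (Z \subset X))) /=; last first.
      by move=> U X _ /andP[-> /(subset_trans (subsetUl _ _))].
    apply: ler_sum => X /andP[XS sZX].
    (* [X] meets [Y] in at least [t] points, of which exactly [t - j] lie in [Z]. *)
    have : (j <= #|(X :&: Y) :\: Z|)%N.
      rewrite cardsD; have := cross _ _ XS YE.
      rewrite (_ : X :&: Y :&: Z = Z :&: Y) 1?setIAC 1?(setIidPr sZX) //.
      exact: leq_sub2r.
    case/card_geqP=> U0 [uniqU sizeU subU].
    pose U := [set x in U0].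
    have cardU : #|U| = j by rewrite cardsE (card_uniqP uniqU).
    have sUXY : U \subset X :&: Y :\: Z.
      by apply/subsetP=> x; rewrite inE => /subU.
    rewrite (bigD1 U) /=; first by rewrite lerDl sumr_ge0 // => *; rewrite exprn_ge0 // ltW.
    rewrite cardU eqxx XS subUset sZX /= andbT (subset_trans sUXY) ?setSD ?subsetIr //=.
    by rewrite (subset_trans sUXY) // subDset subsetU // subsetIl orbT.
  have term (U : {set T}) : (U \subset Y :\: Z) && (#|U| == j) ->
      w (Z :|: U) * r ^+ #|Z| <= w Z * r ^+ #|Z| / r ^+ j.
    case/andP=> sUYZ /eqP cardU; rewrite ler_pdivlMr ?exprn_gt0 //.
    rewrite -mulrA -exprD.
    have <- : #|Z :|: U| = (#|Z| + j)%N.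
      rewrite cardsU cardU (_ : Z :&: U = set0) ?cards0 ?subn0 //.
      apply/eqP; rewrite setI_eq0 disjoint_sym.
      by move: sUYZ; rewrite subsetD => /andP[].
    by apply: maxZ; apply: subset_trans sVZ (subsetUl _ _).
  have := ler_wpM2r (exprn_ge0 #|Z| (ltW r0)) wZ_le.
  apply/negP; rewrite -ltNge mulr_suml.
  apply: le_lt_trans (ler_sum _ term) _.
  rewrite (eq_bigl (fun U =>
    U \in [set U : {set T} | (U \subset Y :\: Z) && (#|U| == j)])); last first.
    by move=> U; rewrite inE.
  rewrite sumr_const cards_draws -mulr_natr mulrAC -mulrA gtr_pMr ?mulr_gt0 ?exprn_gt0 //.
  rewrite ltr_pdivrMr ?exprn_gt0 // mul1r -natrX ltr_nat.
  (* Here [#|Y :\: Z| <= b + j]. Passing from [b.+1] to [b.+2] makes the inequality strict, since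
     [j > 0]. *)
  apply: (@leq_ltn_trans (b.+1 ^ j)); last by rewrite ltn_exp2r.
  apply: leq_trans (leq_bin_expS b j); apply: leq_bin2l.
  by rewrite cardsD setIC; have := sizeE _ YE; rewrite /j; lia.
have maxS X : X \in S -> Z \subset X -> X = Z.
  move=> XS sZX; apply/eqP; rewrite eq_sym; case: eqVneq => // neqZX.
  have [|Y YE] := minS X Z XS; first by rewrite properEneq neqZX.
  by rewrite ltnNge capZ.
have [X XS sZX] : exists2 X, X \in S & Z \subset X.
  move: wZ0; rewrite /w; case: (pickP (fun X => (X \in S) && (Z \subset X))).
    by move=> X /andP[]; exists X.
  by move=> none; rewrite big_pred0 ?ltxx.
have eqXZ := maxS X XS sZX; rewrite eqXZ in XS.
exists Z; first by rewrite XS.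
apply: le_trans (maxZ V (subxx V)) _.
rewrite exprMn /w (big_pred1 Z) // => X'; apply/andP/eqP => [[]|->//].
exact: maxS.
Qed.

End Minimal.

Section MinimalFamilies.
Variables (T : finType) (R : realFieldType).
Implicit Types (X Y Z V : {set T}) (S E : {set {set T}}).

(** Every [X] in [S] contains a [t]-subset [V] of the fixed [Y0]. Above each [V] the weight is
    governed by a single member of [S], whose size is at least [t + k]. *)
Lemma sum_minimal_family t b k (lam : R) S E Y0 : 0 < lam ->
    lam * b.+2%:R <= 1 ->
    cross_intersecting t S E -> minimal_for t S E ->
    (forall Y, Y \in E -> (#|Y| <= t + b)%N) ->
    (forall X, X \in S -> (t + k <= #|X|)%N) -> Y0 \in E ->
  \sum_(X in S) lam ^+ #|X|
    <= 'C(#|Y0|, t)%:R * (lam ^+ t * (lam * b.+2%:R) ^+ k).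
Proof.
move=> lam0 le1 cross minS sizeE sizeS Y0E.
have r0 : 0 < b.+2%:R :> R by rewrite ltr0n.
have lamX m : 0 <= lam ^+ m by rewrite exprn_ge0 // ltW.
apply: (@le_trans _ _ (\sum_(V : {set T} | (V \subset Y0) && (#|V| == t))
          \sum_(X in S | V \subset X) lam ^+ #|X|)).
  rewrite (exchange_big_dep (fun X => X \in S)) /=; last by move=> V X _ /andP[].
  apply: ler_sum => X XS.
  have /card_geqP[V0 [uniqV sizeV subV]] := cross _ _ XS Y0E.
  pose V := [set x in V0].
  have cardV : #|V| = t by rewrite cardsE (card_uniqP uniqV).
  have : V \subset X :&: Y0 by apply/subsetP=> x; rewrite inE => /subV.
  rewrite subsetI => /andP[sVX sVY].
  by rewrite (bigD1 V) /= ?sVY ?cardV ?eqxx ?XS ?sVX //= lerDl sumr_ge0.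
have term V : (V \subset Y0) && (#|V| == t) ->
    \sum_(X in S | V \subset X) lam ^+ #|X| <= lam ^+ t * (lam * b.+2%:R) ^+ k.
  case/andP=> _ /eqP cardV.
  have [pos|npos] := boolP (0 < \sum_(X in S | V \subset X) lam ^+ #|X|); last first.
    rewrite -leNgt in npos; apply: le_trans npos _.
    by rewrite !mulr_ge0 // exprn_ge0 // mulr_ge0 // ltW.
  have [Z /andP[ZS _]] := sum_minimal_above lam0 cross minS sizeE pos.
  rewrite cardV => leZ; rewrite -(ler_pM2r (exprn_gt0 t r0)).
  apply: le_trans leZ _; rewrite mulrAC -exprMn -exprD.
  by apply: ler_wiXn2l; rewrite ?mulr_ge0 ?(ltW lam0) ?(ltW r0) ?sizeS.
apply: le_trans (ler_sum _ term) _.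
rewrite (eq_bigl (fun V => V \in [set V : {set T} | (V \subset Y0) && (#|V| == t)])).
  by rewrite sumr_const cards_draws mulr_natl.
by move=> V; rewrite inE.
Qed.

End MinimalFamilies.

(** * Inequalities for binomial coefficients and powers *)

Section NumericBounds.

Lemma leq_expn_ffact m k : (m ^ k <= (m + k) ^_ k)%N.
Proof.
elim: k => // k IHk; rewrite addnS ffactSS expnS leq_mul //.
by rewrite -addnS leq_addr.
Qed.

Lemma leq_ffact_expn m k : (m ^_ k <= m ^ k)%N.
Proof.
elim: k => // k IHk; rewrite ffactnSr expnSr leq_mul //; exact: leq_subr.
Qed.

Lemma leq_bin_pow2 m k : ('C(m, k) <= 2 ^ m)%N.
Proof.
elim: m k => [|m IHm] [|k] //; first by rewrite bin0 expn_gt0.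
by rewrite binS expnS mul2n -addnn leq_add.
Qed.

(** A division-free form of ['C(t + a, a) <= (4 * (t + a) / a) ^ a], resting on
    [a ^ a <= 'C(2 * a, a) * a!] and ['C(2 * a, a) <= 4 ^ a]. *)
Lemma leq_bin_expn t a : ('C(t + a, t) * a ^ a <= (4 * (t + a)) ^ a)%N.
Proof.
have le_aa : (a ^ a <= 4 ^ a * a`!)%N.
  apply: leq_trans (leq_expn_ffact a a) _.
  by rewrite -bin_ffact leq_mul2r -[4%N]/(2 ^ 2)%N -expnM mul2n -addnn leq_bin_pow2 orbT.
apply: leq_trans (leq_mul (leqnn _) le_aa) _.
rewrite mulnCA expnMn leq_mul2l -bin_sub ?leq_addr // addKn bin_ffact.
by rewrite leq_ffact_expn orbT.
Qed.

Lemma leq_fact_expn m k : (m`! * m ^ k <= (m + k)`!)%N.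
Proof.
elim: k => [|k IHk]; first by rewrite muln1 addn0.
rewrite addnS factS expnS mulnCA leq_mul //; lia.
Qed.

Variable R : realFieldType.

Lemma bernoulli (u : R) a : 0 <= u -> 1 + a%:R * u <= (1 + u) ^+ a.
Proof.
move=> u0; elim: a => [|a IHa]; first by rewrite mul0r addr0.
rewrite exprSr.
apply: le_trans (ler_wpM2r (addr_ge0 ler01 u0) IHa).
have h : 0 <= a%:R * u * u by rewrite !mulr_ge0 ?ler0n.
rewrite -natr1; lra.
Qed.

Lemma expr1D_le2 (u : R) m : 0 <= u -> 2 * (m%:R * u) <= 1 -> (1 + u) ^+ m <= 2.
Proof.
move=> u0 le1; suff : (1 + u) ^+ m <= 1 + 2 * (m%:R * u) by lra.
elim: m le1 => [|m IHm]; first by rewrite !mul0r mulr0 addr0.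
rewrite -natr1 exprSr => le1.
have le1' : 2 * (m%:R * u) <= 1 by lra.
apply: le_trans (ler_wpM2r (addr_ge0 ler01 u0) (IHm le1')) _.
have := ler_wpM2r u0 le1'; lra.
Qed.

Lemma bin_expr_le (y : R) t i : 0 <= y -> ('C(t + i, t))%:R * y ^+ i <= (1 + y) ^+ (t + i).
Proof.
move=> y0; rewrite exprDn.
have lt_i : (i < (t + i).+1)%N by rewrite ltnS leq_addl.
rewrite (bigD1 (Ordinal lt_i)) //= expr1n mul1r.
have -> : 'C(t + i, i) = 'C(t + i, t) by rewrite -[RHS]bin_sub ?leq_addr // addKn.
by rewrite mulr_natl lerDl sumr_ge0 // => j _; rewrite mulrn_wge0 // mulr_ge0 ?exprn_ge0 ?ler01.
Qed.

(** The first factor is at most [(1 + y) ^+ (t + i) <= 2 ^+ a], with no decay because [i] may be 0.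
    The second is at most [(24 * (t + a) / N) ^+ a <= 16^-1 ^+ a], whence the constant 384 = 24 *
    16. *)
Lemma peel_numeric (N y : R) t a i : 0 < N -> (i <= a)%N ->
    384 * (t + a)%:R <= N -> y = 6 * a%:R / N ->
  (('C(t + i, t))%:R * y ^+ i) * (('C(t + a, t))%:R * y ^+ a) <= 8^-1 ^+ a.
Proof.
move=> N0 le_ia leN def_y.
have y0 : 0 <= y by rewrite def_y !mulr_ge0 ?invr_ge0 ?ler0n ?(ltW N0).
have h1 : ('C(t + i, t))%:R * y ^+ i <= 2 ^+ a.
  apply: le_trans (bin_expr_le _ _ y0) _.
  have u0 : 0 <= 6 / N by rewrite divr_ge0 ?ler0n ?ltW.
  have le_y : 1 + y <= (1 + 6 / N) ^+ a.
    by apply: le_trans (bernoulli a u0); rewrite def_y lerD2l mulrA [a%:R * 6]mulrC.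
  apply: (@le_trans _ _ (((1 + 6 / N) ^+ a) ^+ (t + i))).
    by apply: lerXn2r; rewrite ?nnegrE ?exprn_ge0 ?addr_ge0.
  rewrite -exprM mulnC exprM; apply: lerXn2r; rewrite ?nnegrE ?exprn_ge0 ?addr_ge0 ?ler0n //.
  apply: expr1D_le2 => //.
  have : (t + i)%:R <= (t + a)%:R :> R by rewrite ler_nat leq_add2l.
  move=> le_i; rewrite mulrA mulrA ler_pdivrMr //.
  have : 0 <= (t + a)%:R :> R by rewrite ler0n.
  lra.
have h2 : ('C(t + a, t))%:R * y ^+ a <= (24 * (t + a)%:R / N) ^+ a.
  have := leq_bin_expn t a; rewrite -(ler_nat R) natrM !natrX natrM => leB.
  have -> : y ^+ a = a%:R ^+ a * (6 / N) ^+ a by rewrite -exprMn def_y mulrA [a%:R * _]mulrC.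
  have -> : (24 * (t + a)%:R / N) ^+ a = (4 * (t + a)%:R) ^+ a * (6 / N) ^+ a.
    by rewrite -exprMn; congr (_ ^+ _); field; rewrite gt_eqF.
  by rewrite mulrA ler_wpM2r // exprn_ge0 // divr_ge0 ?ler0n ?ltW.
apply: le_trans (ler_pM _ _ h1 h2) _; rewrite ?mulr_ge0 ?exprn_ge0 ?ler0n //.
rewrite -exprMn; apply: lerXn2r; rewrite ?nnegrE ?invr_ge0 ?mulr_ge0 ?invr_ge0 ?ler0n ?(ltW N0) //.
by rewrite mulrA ler_pdivrMr //; lra.
Qed.

End NumericBounds.

(** * The contribution of the largest sites *)

Section Peeling.
Variables (R : realFieldType) (n t : nat).
Implicit Types (X Y Z : {set 'I_n * 'I_n}) (S E : {set {set 'I_n * 'I_n}}).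
Implicit Types (F G : {set 'S_n}).

Local Notation w := ((n - t)`!%:R : R).

Definition covered S : {set 'S_n} := \bigcup_(X in S) extensions X.

(** Since [n - #|X| >= n / 2], each cell beyond [t] reduces the bound [(n - t)!] on the number of
    extensions by a factor of at least [n / 2]. *)
Lemma card_covered S : (0 < n)%N ->
    (forall X, X \in S -> (t <= #|X|)%N /\ (2 * #|X| <= n)%N) ->
  #|covered S|%:R * (2 / n%:R) ^+ t <= w * \sum_(X in S) (2 / n%:R) ^+ #|X|.
Proof.
move=> n0 sizeS.
have N0 : 0 < n%:R :> R by rewrite ltr0n.
have lam0 : 0 < 2 / n%:R :> R by rewrite divr_gt0 ?ltr0n.
have := leq_card_bigcup (mem S) (fun X => extensions X).
rewrite -(ler_nat R) natr_sum => /(ler_wpM2r (exprn_ge0 t (ltW lam0)))/le_trans; apply.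
rewrite mulr_suml mulr_sumr; apply: ler_sum => X /sizeS[tX X2].
have -> : #|X| = (t + (#|X| - t))%N by rewrite subnKC.
rewrite exprD mulrCA mulrC ler_pM2l ?exprn_gt0 //.
have lamX : 0 < (2 / n%:R) ^- (#|X| - t) :> R by rewrite invr_gt0 exprn_gt0.
rewrite -(ler_pM2r lamX) mulfK ?expf_neq0 ?gt_eqF // -exprVn invf_div.
apply: (@le_trans _ _ ((n - #|X|)`!%:R * (n - #|X|)%:R ^+ (#|X| - t))).
  apply: ler_pM; rewrite ?ler0n ?exprn_ge0 ?divr_ge0 ?ler0n //.
    by rewrite ler_nat card_extensions_le.
  apply: lerXn2r; rewrite ?nnegrE ?divr_ge0 ?ler0n //.
  by rewrite ler_pdivrMr ?ltr0n // -natrM ler_nat; lia.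
rewrite -natrX -natrM ler_nat.
have -> : (n - t = n - #|X| + (#|X| - t))%N by lia.
exact: leq_fact_expn.
Qed.

Lemma card_covered_minimal b k S E Y0 : (0 < n)%N -> (2 * b.+2 <= n)%N ->
    cross_intersecting t S E -> minimal_for t S E ->
    (forall Y, Y \in E -> (#|Y| <= t + b)%N) ->
    (forall X, X \in S -> (t + k <= #|X|)%N /\ (2 * #|X| <= n)%N) -> Y0 \in E ->
  #|covered S|%:R <= w * ('C(#|Y0|, t)%:R * (2 / n%:R * b.+2%:R) ^+ k).
Proof.
move=> n0 b2 cross minS sizeE sizeS Y0E.
have N0 : 0 < n%:R :> R by rewrite ltr0n.
have lam0 : 0 < 2 / n%:R :> R by rewrite divr_gt0 ?ltr0n.
rewrite -(ler_pM2r (exprn_gt0 t lam0)).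
apply: le_trans (card_covered n0 _) _.
  by move=> X /sizeS[h ->]; split=> //; apply: leq_trans h; apply: leq_addr.
rewrite -[leRHS]mulrA ler_wpM2l ?ler0n //.
apply: le_trans (sum_minimal_family (k := k) lam0 _ cross minS sizeE _ Y0E) _.
- by rewrite mulrAC ler_pdivrMr // mul1r -natrM ler_nat.
- by move=> X /sizeS[].
by rewrite -[leRHS]mulrA ler_wpM2l ?ler0n // mulrC.
Qed.

(** The top layer of [S] is bounded through a smallest member of [E], of size [t + i], and [E]
    through a member of the top layer. The factors ['C(t + i, t) * y ^+ a] and
    ['C(t + a, t) * y ^+ i] are then regrouped for [peel_numeric]. *)
Lemma peel_product a b S E : (1 <= a)%N -> (b <= a)%N -> (384 * (t + a) <= n)%N ->
    cross_intersecting t S E -> minimal_for t S E -> minimal_for t E S ->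
    (forall X, X \in S -> (#|X| <= t + a)%N) ->
    (forall Y, Y \in E -> (#|Y| <= t + b)%N) ->
  #|covered [set X in S | #|X| == (t + a)%N]|%:R * #|covered E|%:R
    <= 8^-1 ^+ a * w ^+ 2.
Proof.
move=> a1 le_ba le_n cross minS minE sizeS sizeE; set S0 := [set X in S | _].
have n0 : (0 < n)%N by lia.
have N0 : 0 < n%:R :> R by rewrite ltr0n.
have rhs_ge0 : 0 <= 8^-1 ^+ a * w ^+ 2 :> R.
  by rewrite mulr_ge0 ?exprn_ge0 ?invr_ge0 ?ler0n.
have [->|[X0 X0S0]] := set_0Vmem S0.
  by rewrite /covered big_set0 cards0 mul0r.
have [E0|[Y1 Y1E]] := set_0Vmem E.
  by rewrite E0 [covered set0]/covered big_set0 cards0 mulr0.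
case: (arg_minnP (fun Y : {set 'I_n * 'I_n} => #|Y|) Y1E) => Y0 Y0E minY0.
have [X0S /eqP cardX0] : X0 \in S /\ #|X0| == (t + a)%N.
  by move: X0S0; rewrite inE => /andP.
have tY Y : Y \in E -> (t <= #|Y|)%N.
  by move=> YE; apply: leq_trans (cross _ _ X0S YE) _; rewrite subset_leq_card ?subsetIr.
pose i := (#|Y0| - t)%N.
have cardY0 : #|Y0| = (t + i)%N by rewrite subnKC ?tY.
have le_ia : (i <= a)%N by have := sizeE _ Y0E; rewrite cardY0 leq_add2l => /leq_trans; apply.
have leS0 : #|covered S0|%:R <= w * ('C(t + i, t)%:R * (2 / n%:R * b.+2%:R) ^+ a).
  rewrite -cardY0; apply: (@card_covered_minimal b a S0 E) => //; first by lia.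
  - by move=> X Y; rewrite inE => /andP[XS _]; apply: cross.
  - by move=> X X'; rewrite inE => /andP[XS _]; apply: minS.
  - by move=> X; rewrite inE => /andP[_ /eqP->]; lia.
have leE : #|covered E|%:R <= w * ('C(t + a, t)%:R * (2 / n%:R * a.+2%:R) ^+ i).
  rewrite -cardX0; apply: (@card_covered_minimal a i E S) => //; first by lia.
  - by move=> Y X YE XS; rewrite setIC; apply: cross.
  - move=> Y YE; rewrite -cardY0 minY0 //; split=> //.
    by have := sizeE _ YE; lia.
(* For [m <= a] and [a >= 1] one has [2 * (m + 2) <= 6 * a]. *)
pose y : R := 6 * a%:R / n%:R.
have le_y m : (m <= a)%N -> 0 <= 2 / n%:R * m.+2%:R :> R /\ 2 / n%:R * m.+2%:R <= y.
  move=> le_ma; rewrite mulr_ge0 ?divr_ge0 ?ler0n //=; split=> //.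
  rewrite /y mulrAC ler_pM2r ?invr_gt0 //.
  by rewrite -!natrM ler_nat; lia.
have pow_y m k : (m <= a)%N -> (2 / n%:R * m.+2%:R) ^+ k <= y ^+ k.
  by move=> le_ma; have [h0 h1] := le_y m le_ma; apply: lerXn2r => //; rewrite nnegrE (le_trans h0).
have wC (c : nat) m k : (m <= a)%N ->
    w * (c%:R * (2 / n%:R * m.+2%:R) ^+ k) <= w * (c%:R * y ^+ k).
  by move=> le_ma; rewrite !ler_wpM2l ?ler0n ?pow_y.
have := ler_pM (ler0n _ _) (ler0n _ _) (le_trans leS0 (wC _ _ _ le_ba))
  (le_trans leE (wC _ _ _ (leqnn a))).
move=> h; apply: le_trans h _.
have leN : 384 * (t + a)%:R <= n%:R :> R by rewrite -natrM ler_nat.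
have num := peel_numeric N0 le_ia leN (erefl y).
have := ler_wpM2r (exprn_ge0 2 (ler0n R (n - t)`!)) num.
move=> num'; apply: le_trans num'.
by rewrite le_eqVlt; apply/orP; left; apply/eqP; ring.
Qed.

End Peeling.

(** * Peeling down to one site of size [t] *)

Section PeelInduction.
Variables (R : realFieldType) (n t : nat).
Implicit Types (X Y Z : {set 'I_n * 'I_n}) (S E : {set {set 'I_n * 'I_n}}).
Implicit Types (F G : {set 'S_n}).

Local Notation w := ((n - t)`!%:R : R).

Definition total_size S := (\sum_(X in S) #|X|)%N.

(** A member violating minimality is replaced by its offending subset, which covers more
    permutations. Even if that subset already belongs to [S], the total size drops, so the process
    terminates. *)
Lemma minimal_or_shrink k S E : cross_intersecting t S E ->
    (forall X, X \in S -> (#|X| <= t + k)%N) ->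
  minimal_for t S E \/
  exists S', [/\ cross_intersecting t S' E,
                 forall X, X \in S' -> (#|X| <= t + k)%N,
                 covered S \subset covered S' & (total_size S' < total_size S)%N].
Proof.
move=> cross sizeS.
case: (boolP [exists X in S, exists X' : {set 'I_n * 'I_n},
   (X' \proper X) && [forall Y in E, t <= #|X' :&: Y|]%N]).
  case/existsP=> X /andP[XS /existsP[X' /andP[ltX' /forallP capX']]]; right.
  exists (X' |: (S :\ X)); split.
  - move=> Z Y; rewrite !inE => /orP[/eqP->|/andP[_ ZS]] YE; last exact: cross.
    by have := capX' Y; rewrite YE.
  - move=> Z; rewrite !inE => /orP[/eqP->|/andP[_ ZS]]; last exact: sizeS.
    by apply: leq_trans (sizeS _ XS); rewrite subset_leq_card ?proper_sub.
  - rewrite /covered; apply/bigcupsP=> Z ZS; have [->|neq] := eqVneq Z X.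
      apply: (bigcup_max X'); first by rewrite !inE eqxx.
      by rewrite extensionsS ?proper_sub.
    apply: (bigcup_max Z) => //.
    by rewrite !inE neq ZS orbT.
  rewrite /total_size (big_setD1 X XS) /=.
  apply: (@leq_ltn_trans (#|X'| + \sum_(Z in S :\ X) #|Z|)); last first.
    by rewrite ltn_add2r proper_card.
  have [X'S|X'S] := boolP (X' \in S :\ X); last by rewrite big_setU1.
  by rewrite (setUidPr _) ?sub1set ?leq_addl.
move=> none; left=> X X' XS ltX'.
move: none; rewrite negb_exists => /forallP/(_ X); rewrite XS /= negb_exists.
move/forallP/(_ X'); rewrite ltX' /= negb_forall => /existsP[Y].
by rewrite negb_imply -ltnNge => /andP[YE ltY]; exists Y.
Qed.

(* loss a bounds the sum of 8^-k over 1 <= k <= a, the price of peeling a layers. *)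
Definition loss a : R := (1 - 2^-1 ^+ a) / 4.

Lemma lossS a : loss a + 8^-1 ^+ a.+1 <= loss a.+1.
Proof.
have h : 8^-1 ^+ a.+1 <= 2^-1 ^+ a / 8 :> R.
  rewrite exprSr ler_pM2r ?invr_gt0 ?ltr0n //.
  by apply: lerXn2r; rewrite ?nnegrE ?invr_ge0 ?ler0n // lef_pV2 ?posrE ?ltr0n // ler_nat.
have e : 2^-1 ^+ a.+1 = 2^-1 ^+ a / 2 :> R by rewrite exprSr.
by rewrite /loss e; lra.
Qed.

Lemma loss_ge0 a : 0 <= loss a.
Proof.
rewrite /loss divr_ge0 ?ler0n // subr_ge0 exprn_ile1 ?invr_ge0 ?ler0n //.
by rewrite invf_le1 ?ltr0n // ler1n.
Qed.

Lemma loss_le a : loss a <= 4^-1.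
Proof.
have : 0 <= 2^-1 ^+ a :> R by rewrite exprn_ge0 ?invr_ge0 ?ler0n.
by rewrite /loss; lra.
Qed.

Lemma card_remove_top a S F : F \subset covered S ->
  (#|F| <= #|F :&: covered [set X in S | #|X| != (t + a)%N]|
             + #|covered [set X in S | #|X| == (t + a)%N]|)%N.
Proof.
move=> sF; apply: leq_trans (leq_card_setU _ _); apply: subset_leq_card.
apply/subsetP=> s sFs; have /bigcupP[X XS sX] := subsetP sF _ sFs.
rewrite in_setU in_setI sFs /=; apply/orP.
case: (boolP (#|X| == (t + a)%N)) => eqX; [right|left]; apply/bigcupP;
  by exists X; rewrite // inE XS eqX.
Qed.

(** Permutations of [F] covered only by the top layer contribute at most [8^-1 ^+ a.+1 * w ^+ 2] to
    the product, which [lossS] absorbs; [l] carries the loss of the other side. *)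
Lemma peel_step a b S E F G (l : R) Z : (b <= a.+1)%N ->
    (384 * (t + a.+1) <= n)%N ->
    cross_intersecting t S E -> minimal_for t S E -> minimal_for t E S ->
    (forall X, X \in S -> (#|X| <= t + a.+1)%N) ->
    (forall Y, Y \in E -> (#|Y| <= t + b)%N) ->
    F \subset covered S -> G \subset covered E ->
    #|F :&: covered [set X in S | #|X| != (t + a.+1)%N]|%:R * #|G|%:R
      <= #|F :&: covered [set X in S | #|X| != (t + a.+1)%N] :&: extensions Z|%:R
           * #|G :&: extensions Z|%:R + (loss a + l) * w ^+ 2 ->
  #|F|%:R * #|G|%:R <= #|F :&: extensions Z|%:R * #|G :&: extensions Z|%:R
       + (loss a.+1 + l) * w ^+ 2.
Proof.
move=> le_ba le_n cross minS minE sizeS sizeE sF sG.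
set F' := F :&: _ => IH.
have top := peel_product R (ltn0Sn a) le_ba le_n cross minS minE sizeS sizeE.
have := card_remove_top a.+1 sF; rewrite -/F' -(ler_nat R) natrD => leF.
have leG : #|G|%:R <= #|covered E|%:R :> R by rewrite ler_nat subset_leq_card.
have leZ : #|F' :&: extensions Z|%:R <= #|F :&: extensions Z|%:R :> R.
  by rewrite ler_nat subset_leq_card // setSI // subsetIl.
have w2 : 0 <= w ^+ 2 by rewrite exprn_ge0 ?ler0n.
have := ler_wpM2r w2 (lossS a); rewrite mulrDl => lel.
have := ler_wpM2r (ler0n R #|G|) leF; rewrite mulrDl => leFG.
have leGtop := ler_wpM2l (ler0n R #|covered [set X in S | #|X| == (t + a.+1)%N]|) leG.
have leGZ := ler_wpM2r (ler0n R #|G :&: extensions Z|) leZ.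
move: IH; rewrite !mulrDl; move: top lel leFG leGtop leGZ; clear.
move: (#|F'|%:R) (#|G|%:R) (#|covered E|%:R) (#|covered [set _ in _ | _]|%:R) (#|F|%:R).
move: (#|_ :&: _|%:R) (#|_ :&: _|%:R) (#|_ :&: _|%:R).
move: (8^-1 ^+ a.+1 * w ^+ 2) (loss a * w ^+ 2) (loss a.+1 * w ^+ 2) (l * w ^+ 2).
move=> *; lra.
Qed.

(** Shrink until both systems are minimal for each other, then drop the top layer on the side with
    the larger bound, as [peel_product] requires. [Z0] serves as the witness when a family is
    empty. *)
Lemma peel (Z0 : {set 'I_n * 'I_n}) a b S E F G : #|Z0| = t ->
    (384 * (t + a) <= n)%N -> (384 * (t + b) <= n)%N ->
    cross_intersecting t S E ->
    (forall X, X \in S -> (#|X| <= t + a)%N) ->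
    (forall Y, Y \in E -> (#|Y| <= t + b)%N) ->
    F \subset covered S -> G \subset covered E ->
  exists2 Z : {set 'I_n * 'I_n}, #|Z| = t &
    #|F|%:R * #|G|%:R <= #|F :&: extensions Z|%:R * #|G :&: extensions Z|%:R
       + (loss a + loss b) * w ^+ 2.
Proof.
move=> cardZ0; have [m] := ubnP (a + b + total_size S + total_size E).
elim: m a b S E F G => // m IHm a b S E F G le_m le_a le_b cross sizeS sizeE sF sG.
have crossC : cross_intersecting t E S.
  by move=> Y X YE XS; rewrite setIC; apply: cross.
have [minS|[S' [cross' sizeS' sSS' ltS']]] := minimal_or_shrink cross sizeS; last first.
  apply: (IHm a b S' E) => //; last exact: subset_trans sSS'.
  by move: le_m ltS'; clear; lia.
have [minE|[E' [cross' sizeE' sEE' ltE']]] := minimal_or_shrink crossC sizeE; last first.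
  apply: (IHm a b S E') => //; last exact: subset_trans sEE'.
    by move: le_m ltE'; clear; lia.
  by move=> X Y XS YE; rewrite setIC; apply: cross'.
have total_sub c S1 : (total_size [set X in S1 | #|X| != c] <= total_size S1)%N.
  rewrite /total_size [leqRHS](big_setID [set X in S1 | #|X| != c]) /=.
  rewrite (setIidPr _) ?leq_addr //.
  by apply/subsetP=> X; rewrite inE => /andP[].
have size_sub c S1 : (forall X, X \in S1 -> (#|X| <= t + c.+1)%N) ->
    forall X, X \in [set X in S1 | #|X| != (t + c.+1)%N] -> (#|X| <= t + c)%N.
  move=> sizeS1 X; rewrite inE => /andP[/sizeS1]; clear; lia.
have [le_ba|lt_ab] := leqP b a.
  case: a => [|a] in le_m le_a sizeS le_ba *.
    move: le_ba; rewrite leqn0 => /eqP b0; rewrite b0 addn0 in sizeE; rewrite addn0 in sizeS.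
    have rhs_ge0 x y : 0 <= x%:R * y%:R + (loss 0 + loss b) * w ^+ 2.
      by rewrite addr_ge0 ?mulr_ge0 ?ler0n ?addr_ge0 ?loss_ge0 ?exprn_ge0 ?ler0n.
    have [F0|[s /(subsetP sF)/bigcupP[X XS _]]] := set_0Vmem F.
      by exists Z0; rewrite // {1}F0 cards0 mul0r.
    have [G0|[u /(subsetP sG)/bigcupP[Y YE _]]] := set_0Vmem G.
      by exists Z0; rewrite // {1}G0 cards0 mulr0.
    (* All sites now have at most [t] cells and meet in at least [t], so they all coincide. *)
    have eqXY X1 Y1 : X1 \in S -> Y1 \in E -> X1 = Y1 /\ #|X1| = t.
      move=> X1S Y1E; have le_t := cross _ _ X1S Y1E.
      have eqX : X1 :&: Y1 = X1.
        by apply/eqP; rewrite eqEcard subsetIl (leq_trans (sizeS _ X1S)).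
      have eqY : X1 :&: Y1 = Y1.
        by apply/eqP; rewrite eqEcard subsetIr (leq_trans (sizeE _ Y1E)).
      split; first by rewrite -eqX.
      by apply/eqP; rewrite eqn_leq sizeS //= (leq_trans le_t) // subset_leq_card ?subsetIl.
    have [_ cardX] := eqXY _ _ XS YE.
    exists X => //; rewrite (setIidPl _) 1?(setIidPl _).
    - by rewrite lerDl mulr_ge0 ?addr_ge0 ?loss_ge0 // exprn_ge0 ?ler0n.
    - apply: subset_trans sG _; apply/bigcupsP=> Y1 Y1E.
      by have [-> _] := eqXY _ _ XS Y1E.
    apply: subset_trans sF _; apply/bigcupsP=> X1 X1S.
    by have [-> _] := eqXY _ _ XS YE; have [-> _] := eqXY _ _ X1S YE.
  have [] := IHm a b [set X in S | #|X| != (t + a.+1)%N] E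
    (F :&: covered [set X in S | #|X| != (t + a.+1)%N]) G => //.
  - by move: le_m (total_sub (t + a.+1)%N S); clear; lia.
  - by move: le_a; clear; lia.
  - by move=> X Y; rewrite inE => /andP[XS _]; apply: cross.
  - exact: size_sub.
  - exact: subsetIr.
  move=> Z cardZ leZ; exists Z => //.
  exact: (peel_step le_ba le_a cross minS minE sizeS sizeE sF sG leZ).
case: b => // b in le_m le_b sizeE lt_ab *.
have [] := IHm a b S [set X in E | #|X| != (t + b.+1)%N] F
    (G :&: covered [set X in E | #|X| != (t + b.+1)%N]) => //.
- by move: le_m (total_sub (t + b.+1)%N E); clear; lia.
- by move: le_b; clear; lia.
- by move=> X Y XS; rewrite inE => /andP[YE _]; apply: cross.
- exact: size_sub.
- exact: subsetIr.
move=> Z cardZ leZ; exists Z => //.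
rewrite mulrC [X in _ <= X + _]mulrC [loss a + _]addrC.
apply: (peel_step (ltnW lt_ab) le_b crossC minE minS sizeE sizeS sG sF).
by rewrite mulrC [X in _ <= X + _]mulrC [loss b + _]addrC.
Qed.

End PeelInduction.

(** * Counting permutations with prescribed agreements *)

Section PrescribedAgreement.
Variable n : nat.
Implicit Types (s u : 'S_n) (X Z : {set 'I_n * 'I_n}).

(** Swapping the values of [u] at [i] and at the preimage of [j] changes only rows outside [X]. *)
Lemma extend_cell u X i j : X \subset graph u ->
    (forall l, (i, l) \notin X) -> (forall k, (k, j) \notin X) ->
  exists u', (i, j) |: X \subset graph u'.
Proof.
move=> sXu iX jX; exists (tperm i (u^-1%g j) * u)%g.
apply/subsetP=> -[k l]; rewrite in_setU1 inE /= permM => /orP[/eqP[-> ->]|klX].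
  by rewrite tpermL permKV.
have := subsetP sXu _ klX; rewrite inE /= => /eqP eq_l.
rewrite tpermD ?eq_l //.
  by apply: contraTneq klX => <-.
by apply: contraTneq klX => def_k; rewrite -eq_l -def_k permKV.
Qed.

(** Take the extension with fewest agreements with [s] outside [X]. If one remained at row [i],
    swapping values with another free row [i'] would leave both rows without agreement, a
    contradiction. *)
Lemma exists_avoiding_extension s u X : X \subset graph u -> (#|X| + 2 <= n)%N ->
  exists2 u', u' \in extensions X & graph u' :&: graph s \subset X.
Proof.
move=> sXu leX; have uX : u \in extensions X by rewrite inE.
case: (@arg_minnP _ u (fun v => v \in extensions X)
  (fun v => #|(graph v :&: graph s) :\: X|) uX) => v vX minv.
exists v => //; rewrite -setD_eq0; apply/set0Pn => -[[i j]].
rewrite !inE /= => /and3P[ijX /eqP def_j /eqP sij].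
have sXv : X \subset graph v by move: vX; rewrite inE.
have [i' i'X neq_i'] : exists2 i', (i', v i') \notin X & i' != i.
  have : (1 < #|graph v :\: X|)%N by rewrite cardsD (setIidPr sXv) card_graph; lia.
  rewrite (cardsD1 (i, j)) => lt1.
  have /card_gt0P[[i' j']] : (0 < #|(graph v :\: X) :\ (i, j)|)%N.
    by rewrite -ltnS; apply: leq_trans lt1 _; rewrite -[leqRHS]add1n leq_add2r leq_b1.
  rewrite !inE /= xpair_eqE => /and3P[neq i'X /eqP def_j']; exists i'.
    by rewrite def_j'.
  by apply: contra neq => /eqP eq_i; rewrite eq_i eqxx /= -def_j' eq_i def_j.
pose v' := (tperm i i' * v)%g.
have v'E k : k != i -> k != i' -> v' k = v k.
  by move=> ki ki'; rewrite permM tpermD // eq_sym.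
have v'X : v' \in extensions X.
  rewrite inE; apply/subsetP=> -[k l] klX.
  have := subsetP sXv _ klX; rewrite !inE /= => /eqP def_l.
  rewrite v'E ?def_l //; apply: contraTneq klX => eq_k.
    by rewrite -def_l eq_k def_j.
  by rewrite -def_l eq_k.
have := minv v' v'X; rewrite leqNgt => /negP[]; apply: proper_card.
apply/properP; split.
  apply/subsetP=> -[k l]; rewrite !inE /= => /and3P[-> /eqP def_l /eqP skl].
  have [eq_k|ki] := eqVneq k i.
    move: def_l; rewrite eq_k permM tpermL -skl eq_k sij -def_j => /perm_inj eq_i.
    by rewrite eq_i eqxx in neq_i'.
  have [eq_k|ki'] := eqVneq k i'.
    move: def_l; rewrite eq_k permM tpermR -skl def_j -sij eq_k => /perm_inj eq_i.
    by rewrite eq_i eqxx in neq_i'.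
  by rewrite -v'E // def_l skl !eqxx.
exists (i, j); rewrite !inE /= ?ijX ?def_j ?sij ?eqxx //.
by rewrite permM tpermL -def_j (inj_eq perm_inj) (negbTE neq_i') andbF.
Qed.

(** A derangement-type bound: with [m] rows left, a free row [i] still has at least [m - 1]
    admissible columns other than [s i], down to [m = 2], where one extension suffices. *)
Lemma card_avoiding_extensions s u X : X \subset graph u -> (#|X| + 2 <= n)%N ->
  ((n - #|X|).-1`! <= #|[set v in extensions X | graph v :&: graph s \subset X]|)%N.
Proof.
elim: {X}(n - #|X| - 2)%N {-2}X u (erefl (n - #|X| - 2)%N) => [|m IHm] X u def_m sXu leX.
  rewrite (_ : n - #|X| = 2)%N; last by lia.
  rewrite card_gt0; apply/set0Pn.
  have [v vX vs] := exists_avoiding_extension s sXu leX.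
  by exists v; rewrite inE vX.
have def_m3 : (n - #|X| = m.+3)%N by lia.
have sizeu : (0 < #|graph u :\: X|)%N.
  by rewrite cardsD (setIidPr sXu) card_graph def_m3.
have /card_gt0P[[i j0]] := sizeu; rewrite !inE /= => /andP[ijX /eqP def_j0].
have iX l : (i, l) \notin X.
  apply: contra ijX => ilX; have := subsetP sXu _ ilX; rewrite inE /= => /eqP.
  by rewrite def_j0 => ->.
pose J : {set 'I_n} := ~: [set z.2 | z in X] :\ s i.
have leJ : (m.+2 <= #|J|)%N.
  have leC : (m.+3 <= #|~: [set z.2 | z in X]|)%N.
    by rewrite cardsCs setCK card_ord -def_m3 leq_sub2l // leq_imset_card.
  rewrite -ltnS; apply: leq_trans leC _.
  by rewrite (cardsD1 (s i) (~: _)) -[leqRHS]add1n leq_add2r leq_b1.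
set D := [set v in _ | _].
apply: (@leq_trans (\sum_(j in J) #|[set v in D | v i == j]|)); last first.
  rewrite -[leqRHS]sum1_card (partition_big (fun v : 'S_n => v i) xpredT) //=.
  rewrite [leqRHS](bigID (mem J)) /= (leq_trans _ (leq_addr _ _)) //.
  by apply: leq_sum => j _; rewrite sum1dep_card.
rewrite def_m3 /= factS; apply: leq_trans (leq_mul leJ (leqnn _)) _.
rewrite -sum_nat_const; apply: leq_sum => j; rewrite !inE => /andP[neq_j jX].
have jX' k : (k, j) \notin X by apply: contra jX => kjX; apply/imsetP; exists (k, j).
have [u' su'] := extend_cell sXu iX jX'.
have card' : #|(i, j) |: X| = #|X|.+1 by rewrite cardsU1 iX.
have := IHm ((i, j) |: X) u' _ su' _; rewrite card' => IH.
have def_m' : (n - #|X|.+1 = m.+2)%N by lia.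
rewrite -[m.+1`!]/(m.+2.-1`!) -def_m'.
apply: leq_trans (IH _ _) _; try by lia.
apply: subset_leq_card; apply/subsetP=> v; rewrite !inE subUset sub1set inE /=.
case/andP=> /andP[/eqP vij ->] sub; rewrite vij eqxx andbT /=.
apply/subsetP=> z zvs; have := subsetP sub _ zvs; rewrite in_setU1 => /orP[/eqP eqz|//].
move: zvs; rewrite eqz !inE /= => /andP[_ /eqP sij].
by rewrite sij eqxx in neq_j.
Qed.

(** Cells of [graph s] are added one at a time. [X] blocks at most [2 * #|X|] rows, through its rows
    and the preimages under [s] of its columns. *)
Lemma extend_agreements s k u X : X \subset graph u -> (2 * (#|X| + k) < n)%N ->
  exists X' u', [/\ X \subset X', X' \subset graph u', #|X'| = (#|X| + k)%N &
     #|graph s :&: X'| = (#|graph s :&: X| + k)%N].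
Proof.
elim: k u X => [|k IHk] u X sXu ltn; first by exists X, u; rewrite !addn0.
have [i iX sX] : exists2 i, (forall l, (i, l) \notin X) & (forall l, (l, s i) \notin X).
  pose B := [set z.1 | z in X] :|: [set (s^-1)%g z.2 | z in X].
  have : (#|B| < n)%N.
    apply: leq_ltn_trans (leq_card_setU _ _) _.
    apply: leq_ltn_trans (leq_add (leq_imset_card _ _) (leq_imset_card _ _)) _.
    by rewrite addnn -mul2n; apply: leq_ltn_trans ltn; rewrite leq_mul2l leq_addr orbT.
  rewrite -[X in (_ < X)%N]card_ord -cardsT => ltB.
  have : ~~ ([set: 'I_n] \subset B).
    by apply/negP=> /subset_leq_card; rewrite leqNgt ltB.
  case/subsetPn=> i _; rewrite inE => /norP[iX siX]; exists i => l.
    by apply: contra iX => ilX; apply/imsetP; exists (i, l).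
  by apply: contra siX => ilX; apply/imsetP; exists (l, s i) => //; rewrite /= permK.
have [u' su'] := extend_cell sXu iX sX.
have cardX' : #|(i, s i) |: X| = #|X|.+1 by rewrite cardsU1 iX.
have [|X' [u2 [sXX' sX'u cX' cs]]] := IHk u' _ su'; first by rewrite cardX' addSnnS.
exists X', u2; split=> //; first exact: subset_trans (subsetUr _ _) sXX'.
  by rewrite cX' cardX' addSnnS.
rewrite cs setIUr (setIidPr _) ?sub1set ?inE //.
by rewrite cardsU1 inE (negbTE (iX _)) andbF addSnnS.
Qed.

(** Enlarge [Z] by cells of [s] until exactly [t - 1] agreements are present, then allow no more.
    The enlarged set has at most [2 * t - 1] cells. *)
Lemma card_prescribed_agreement t s u Z : (0 < t)%N -> (4 * t < n)%N ->
    #|Z| = t -> Z \subset graph u -> ~~ (Z \subset graph s) ->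
  ((n - 2 * t)`!
     <= #|[set v in extensions Z | #|graph s :&: graph v| == (t - 1)%N]|)%N.
Proof.
move=> t0 t4 cardZ sZu nsZ.
have ltsZ : (#|graph s :&: Z| < t)%N.
  rewrite -cardZ; apply: proper_card; rewrite properEneq subsetIr andbT.
  by apply: contra nsZ => /eqP/setIidPr.
pose k := (t - 1 - #|graph s :&: Z|)%N.
have [|X [u' [sZX sXu cardX card_sX]]] := extend_agreements s (k := k) sZu.
  by rewrite cardZ /k; lia.
have leX : (#|X| + 2 <= n)%N by rewrite cardX cardZ /k; lia.
apply: leq_trans (leq_trans (card_avoiding_extensions s sXu leX) _).
  by rewrite leq_fact // cardX cardZ /k; lia.
apply: subset_leq_card; apply/subsetP=> v; rewrite !inE => /andP[sXv svX].
rewrite (subset_trans sZX sXv) /=.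
have -> : graph s :&: graph v = graph s :&: X.
  apply/eqP; rewrite eqEsubset (setIS _ sXv) andbT subsetI subsetIl.
  by rewrite setIC svX.
by rewrite card_sX /k; apply/eqP; lia.
Qed.

End PrescribedAgreement.

(** * The two families *)

Section Main.
Variables (R : realFieldType) (n t : nat).
Local Notation A := (11 / 10 : R).
Local Notation w := ((n - t)`!%:R : R).
Implicit Types (X Y Z U : {set 'I_n * 'I_n}) (F G : {set 'S_n}).

Hypothesis n_gt1 : (1 < n)%N.
Hypothesis t_gt0 : (0 < t)%N.
(* The only form in which t <= c n / log n is used. *)
Hypothesis A_growth : forall x, A ^+ x <= (n ^ (4 * t))%:R -> (x * 1000 <= n)%N.

Lemma t_small : (t * 1000 <= n)%N.
Proof.
apply: A_growth; rewrite natrX; apply: (@le_trans _ _ (n%:R ^+ t)).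
  apply: lerXn2r; rewrite ?nnegrE ?ler0n ?(ltW (A_gt0 R)) //.
  have : 2 <= n%:R :> R by rewrite ler_nat.
  lra.
by apply: ler_weXn2l; rewrite ?ler1n ?(ltnW n_gt1) // leq_pmull.
Qed.

Lemma n_ge1000 : (1000 <= n)%N.
Proof. by apply: leq_trans t_small; rewrite leq_pmull. Qed.

(** The density threshold: low enough that discarded parts are negligible ([p_fact2], [p_fact_le]),
    high enough that sites remain small after up to [t] losses of a factor 16. *)
Local Notation p := ((n ^ (3 * t))%:R^-1 : R).

Lemma natrX_gt0 k : 0 < (n ^ k)%:R :> R.
Proof. by rewrite ltr0n expn_gt0 (ltnW n_gt1). Qed.

Lemma p_gt0 : 0 < p. Proof. by rewrite invr_gt0 natrX_gt0. Qed.

(** The score bound gives [A ^+ #|X| <= 16 ^ t * n ^ (3 * t) <= n ^ (4 * t)], which explains the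
    exponent in [A_growth]. *)
Lemma score_small k F X : (k <= t)%N -> p <= 16 ^+ k * score A F X -> small X.
Proof.
move=> le_kt le_p; apply: A_growth.
have sc : score A F X * A ^+ #|X| <= 1 by rewrite score_le1 ?A_gt0.
have AX : 0 < A ^+ #|X| by rewrite exprn_gt0 ?A_gt0.
have N3 := natrX_gt0 (3 * t).
have pA : p * A ^+ #|X| <= 16 ^+ k.
  apply: le_trans (ler_wpM2r (ltW AX) le_p) _.
  by rewrite -mulrA ler_piMr // exprn_ge0 ?ler0n.
rewrite mulrC ler_pdivrMr // in pA; apply: le_trans pA _.
rewrite -natrX -natrM ler_nat -[4%N]/(1 + 3)%N mulnDl mul1n expnD leq_mul2r.
apply/orP; right.
apply: (@leq_trans (16 ^ t)); first by rewrite leq_exp2l.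
by rewrite leq_exp2r // (leq_trans _ n_ge1000).
Qed.

Definition avoids F G :=
  forall s u, s \in F -> u \in G -> #|graph s :&: graph u| <> (t - 1)%N.

Lemma avoidsC F G : avoids F G -> avoids G F.
Proof. by move=> avFG s u sG uF; rewrite setIC; apply: avFG. Qed.

(** Otherwise adding [t - 1 - #|X :&: Y|] common cells would produce a forbidden pair. *)
Lemma caps_meet F G F' G' X Y : avoids F G -> F' \subset F -> G' \subset G ->
    global A F' X -> global A G' Y -> p <= score A F' X -> p <= score A G' Y ->
  (t <= #|X :&: Y|)%N.
Proof.
move=> avFG sF sG globX globY pX pY; rewrite leqNgt; apply/negP=> ltXY.
have le_kt : (t - 1 - #|X :&: Y| <= t)%N by rewrite -subnDA leq_subr.
have [] := exists_agreement_card n_ge1000 p_gt0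
  (fun F0 X0 => @score_small _ F0 X0 le_kt) globX globY pX pY.
move=> s [u [sF' uG']]; rewrite subnKC; last by rewrite subn1 -ltnS prednK.
exact: (avFG _ _ (subsetP sF _ sF') (subsetP sG _ uG')).
Qed.

(** Globalness is spelled out as a boolean so that these sites form a finite set. *)
Definition caps F : {set {set 'I_n * 'I_n}} :=
  [set X : {set 'I_n * 'I_n} | [exists F' : {set 'S_n},
     [&& F' \subset F, [forall (U : {set 'I_n * 'I_n} | X \subset U), score A F' U <= score A F' X]
       & p <= score A F' X]]].

Lemma capsP F X : reflect (exists F', [/\ F' \subset F, global A F' X & p <= score A F' X])
  (X \in caps F).
Proof.
rewrite inE; apply: (iffP existsP) => -[F'].
  case/and3P=> sF /forallP globX pX; exists F'; split=> // U sXU.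
  by have := globX U; rewrite sXU.
case=> sF globX pX; exists F'; rewrite sF pX andbT; apply/forallP=> U.
by apply/implyP; apply: globX.
Qed.

(** At the empty site the score is the plain density. If the uncovered part had density [p], it
    would be global at some site of [caps F] contained in one of its own members. *)
Lemma card_uncovered F : #|F :\: covered (caps F)|%:R < p * n`!%:R.
Proof.
rewrite ltNge; apply/negP=> le_p; set F' := F :\: _ in le_p.
have [X [_ globX leX]] := exists_global A F' set0.
have pX : p <= score A F' X.
  apply: le_trans leX; rewrite /score extensions0 setIT cards0 subn0 expr0 mulr1.
  by rewrite ler_pdivlMr // ltr0n fact_gt0.
have : 0 < score A F' X by apply: lt_le_trans p_gt0 pX.
rewrite score_gt0 ?A_gt0 // => /set0Pn[s]; rewrite in_setI in_setD -andbA.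
case/and3P=> /negP nc _ sX; apply: nc; apply/bigcupP; exists X => //; apply/capsP.
by exists F'; split=> //; apply: subsetDl.
Qed.

Lemma fact_le_expn : n`!%:R <= (n ^ t)%:R * w.
Proof.
have le_tn : (t <= n)%N by apply: leq_trans t_small; rewrite leq_pmulr.
by rewrite -natrM ler_nat -(ffact_fact le_tn) leq_mul2r leq_ffact_expn orbT.
Qed.

Lemma p_fact2 : p * n`!%:R ^+ 2 <= w ^+ 2 / 8.
Proof.
have N0 := natrX_gt0 t.
have h : n`!%:R ^+ 2 <= ((n ^ t)%:R * w) ^+ 2 :> R.
  by apply: lerXn2r; rewrite ?nnegrE ?mulr_ge0 ?ler0n ?fact_le_expn.
apply: le_trans (ler_wpM2l (ltW p_gt0) h) _.
have -> : (n ^ (3 * t))%:R = (n ^ t)%:R ^+ 3 :> R by rewrite -natrX -expnM mulnC.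
have N8 : 8 <= (n ^ t)%:R :> R.
  rewrite ler_nat; apply: (@leq_trans n); first exact: leq_trans n_ge1000.
  by rewrite -[X in (X <= _)%N]expn1 leq_exp2l.
move: N0 N8; move: (n ^ t)%:R w => N v N0 N8.
rewrite [leLHS](_ : _ = v ^+ 2 / N); last by field; rewrite gt_eqF.
by rewrite ler_wpM2l ?sqr_ge0 // lef_pV2 ?posrE ?ltr0n.
Qed.

Lemma card_ext_le_w Z F : #|Z| = t -> #|F :&: extensions Z|%:R <= w.
Proof.
move=> cardZ; rewrite ler_nat -cardZ; apply: leq_trans (card_extensions_le Z).
by rewrite subset_leq_card ?subsetIr.
Qed.

(** The constant 3/4 is made of two peeling losses of 1/4 and two uncovered parts of 1/8. *)
Lemma exists_center F G : avoids F G ->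
  exists2 Z : {set 'I_n * 'I_n}, #|Z| = t &
    #|F|%:R * #|G|%:R <= #|F :&: extensions Z|%:R * #|G :&: extensions Z|%:R
       + 3 / 4 * w ^+ 2.
Proof.
move=> avFG.
have [Z0 cardZ0] : exists Z0 : {set 'I_n * 'I_n}, #|Z0| = t.
  have : (t <= #|graph (1%g : 'S_n)|)%N.
    by rewrite card_graph (leq_trans _ t_small) // leq_pmulr.
  case/card_geqP=> Z1 [uniqZ sizeZ _]; exists [set x in Z1].
  by rewrite cardsE (card_uniqP uniqZ).
(* Sites in [caps] have at most [n / 1000] cells, and [384 * (t + a) <= n] leaves room for
   peeling. *)
pose a := (n %/ 1000)%N.
have le_a : (384 * (t + a) <= n)%N.
  by have := leq_divM n 1000; have := t_small; rewrite -/a; clear; lia.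
have size_caps F0 X : X \in caps F0 -> (#|X| <= t + a)%N.
  case/capsP=> F' [_ _ pX].
  have : small X by apply: (@score_small 0 F'); rewrite // expr0 mul1r.
  by rewrite /small -leq_divRL // => /leq_trans; apply; apply: leq_addl.
have cross : cross_intersecting t (caps F) (caps G).
  move=> X Y /capsP[F' [sF globX pX]] /capsP[G' [sG globY pY]].
  exact: (caps_meet avFG sF sG globX globY pX pY).
have [Z cardZ leZ] := peel R cardZ0 le_a le_a cross (@size_caps F) (@size_caps G)
  (subsetIr F _) (subsetIr G _).
exists Z => //.
have splitF F0 : #|F0|%:R <= #|F0 :&: covered (caps F0)|%:R + p * n`!%:R.
  rewrite -(cardsID (covered (caps F0)) F0) natrD lerD2l.
  exact: ltW (card_uncovered F0).
have le_fact F0 : #|F0|%:R <= n`!%:R :> R.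
  by rewrite ler_nat (leq_trans (max_card _)) // card_Sn.
have le_ext F0 C : #|F0 :&: C :&: extensions Z|%:R <= #|F0 :&: extensions Z|%:R :> R.
  by rewrite ler_nat subset_leq_card // setSI // subsetIl.
have p0 := p_gt0; have pw := p_fact2; have lossa := loss_le R a.
have w2 : 0 <= w ^+ 2 by rewrite exprn_ge0 ?ler0n.
have lossw : (loss R a + loss R a) * w ^+ 2 <= w ^+ 2 / 2.
  by rewrite mulrC ler_wpM2l //; lra.
have h1 := ler_pM (ler0n _ _) (ler0n _ _)
  (le_ext F (covered (caps F))) (le_ext G (covered (caps G))).
have m0 : 0 <= n`!%:R :> R by rewrite ler0n.
have pm : 0 <= p * n`!%:R by rewrite mulr_ge0 // ltW.
have h2 := ler_wpM2r (ler0n R #|G|) (splitF F).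
have h3 := ler_wpM2l (ler0n R #|F :&: covered (caps F)|) (splitF G).
have h4 := ler_wpM2l pm (le_fact G).
have h5 := ler_wpM2r pm (le_fact (F :&: covered (caps F))).
move: leZ lossw h1 h2 h3 h4 h5 pw; clear.
move: (#|F :&: covered _|%:R) (#|G :&: covered _|%:R) (#|F|%:R) (#|G|%:R).
move: (#|_ :&: _|%:R * #|_ :&: _|%:R) (#|_ :&: _|%:R * #|_ :&: _|%:R).
move: (w ^+ 2) ((_ + _) * _) => v l x y f1 g1 f g h h1 h2 h3 h4 h5 h6 h7.
lra.
Qed.

(** If not, the part of [F] outside [Z] is global at a site [X] not containing [Z]. The members of
    [G] above [Z] that avoid [X] are still dense and become global at some [Y] above [Z]; then
    [X :&: Y] is a proper subset of [Z], against [caps_meet]. *)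
Lemma card_outside F G Z : avoids F G -> #|Z| = t ->
  w / 4 <= #|G :&: extensions Z|%:R -> #|F :\: extensions Z|%:R < p * n`!%:R.
Proof.
move=> avFG cardZ leG; rewrite ltNge; apply/negP=> le_p; set F' := F :\: _ in le_p.
have [X [_ globX leX]] := exists_global A F' set0.
have pX : p <= score A F' X.
  apply: le_trans leX; rewrite /score extensions0 setIT cards0 subn0 expr0 mulr1.
  by rewrite ler_pdivlMr // ltr0n fact_gt0.
have nsZX : ~~ (Z \subset X).
  have : 0 < score A F' X by apply: lt_le_trans p_gt0 pX.
  rewrite score_gt0 ?A_gt0 // => /set0Pn[s]; rewrite !inE -!andbA => /and3P[nsZ _ sX].
  by apply: contra nsZ => sZX; apply: subset_trans sX.
have smX : small X by apply: (@score_small 0 F'); rewrite // expr0 mul1r.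
pose G' := avoiding G Z X.
have leG' : w / 8 <= #|G'|%:R.
  have := leq_card_avoiding G Z X; rewrite -(ler_nat R) natrD natr_sum => le1.
  have le2 : \sum_(e in X :\: Z) #|G :&: extensions (e |: Z)|%:R
      <= #|X|%:R * (n - t).-1`!%:R :> R.
    apply: (@le_trans _ _ (\sum_(e in X :\: Z) (n - t).-1`!%:R)).
      apply: ler_sum => e; rewrite inE => /andP[eZ _]; rewrite ler_nat.
      apply: leq_trans (subset_leq_card (subsetIr _ _)) _.
      apply: leq_trans (card_extensions_le _) _.
      by rewrite cardsU1 eZ cardZ /= add1n subnS.
    rewrite sumr_const -[leLHS]mulr_natl ler_wpM2r ?ler0n // ler_nat.
    by rewrite subset_leq_card // subsetDl.
  (* Avoiding [X] costs at most [w / 8], half of the assumed [w / 4]. *)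
  have le3 : 8 * (#|X|%:R * (n - t).-1`!%:R) <= w.
    have le_nt : (8 * #|X| <= n - t)%N.
      by move: smX t_small; rewrite /small; clear; lia.
    have nt0 : (0 < n - t)%N.
      by rewrite subn_gt0 (leq_trans _ t_small) // ltn_Pmulr.
    rewrite -!natrM ler_nat mulnA.
    case: (n - t)%N nt0 le_nt => // m _ le_m.
    by rewrite factS leq_mul2r le_m orbT.
  by move: leG le1; rewrite -/G'; lra.
have pG' : p <= score A G' Z.
  rewrite /score (_ : G' :&: _ = G'); last first.
    by apply/setIidPl/subsetP=> u; rewrite inE => /andP[/setIP[]].
  rewrite cardZ ler_pdivlMr; last by rewrite mulr_gt0 ?exprn_gt0 ?A_gt0 // ltr0n fact_gt0.
  apply: le_trans leG'; rewrite mulrCA ler_wpM2l ?ler0n // mulrC.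
  rewrite ler_pdivrMr ?natrX_gt0 // [leRHS]mulrC ler_pdivlMr //.
  apply: (@le_trans _ _ ((n ^ t)%:R * (n ^ t)%:R)); last first.
    rewrite -natrM -expnD ler_nat leq_exp2l //; clear; lia.
  apply: ler_pM; rewrite ?exprn_ge0 ?ler0n ?(ltW (A_gt0 R)) //.
    rewrite natrX; apply: lerXn2r; rewrite ?nnegrE ?ler0n ?(ltW (A_gt0 R)) //.
    have : 2 <= n%:R :> R by rewrite ler_nat.
    lra.
  rewrite ler_nat; apply: (@leq_trans n); first exact: leq_trans n_ge1000.
  by rewrite -[X in (X <= _)%N]expn1 leq_exp2l.
have [Y [sZY globY leY]] := exists_global A G' Z.
have pY := le_trans pG' leY.
have sXYZ : X :&: Y \subset Z.
  have : 0 < score A G' Y by apply: lt_le_trans p_gt0 pY.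
  rewrite score_gt0 ?A_gt0 // => /set0Pn[u]; rewrite !inE => /andP[/andP[_ sXZ] sYu].
  by apply: subset_trans sXZ; rewrite setIC setSI.
have sG : G' \subset G by apply/subsetP=> u; rewrite inE => /andP[/setIP[]].
have := caps_meet avFG (subsetDl _ _) sG globX globY pX pY.
rewrite leqNgt -cardZ => /negP[]; apply: proper_card; rewrite properEneq sXYZ andbT.
by apply: contra nsZX => /eqP <-; apply: subsetIl.
Qed.

Lemma card_inside F G Z s : avoids F G -> #|Z| = t -> s \in F :\: extensions Z ->
    G :&: extensions Z != set0 ->
  #|G :&: extensions Z|%:R <= w - (n - 2 * t)`!%:R.
Proof.
move=> avFG cardZ; rewrite inE => /andP[sNZ sF] /set0Pn[u /setIP[_ uZ]].
rewrite inE in uZ; rewrite inE in sNZ.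
have t4 : (4 * t < n)%N by move: t_small t_gt0; clear; lia.
have := card_prescribed_agreement t_gt0 t4 cardZ uZ sNZ.
set D := [set v in _ | _] => leD.
rewrite lerBrDr -natrD ler_nat; apply: leq_trans (leq_add (leqnn _) leD) _.
have dis : [disjoint G :&: extensions Z & D].
  rewrite disjoints_subset; apply/subsetP=> v; rewrite !inE => /andP[vG _].
  by rewrite negb_and; apply/orP; right; apply/eqP; apply: avFG.
have := leq_card_setU (G :&: extensions Z) D; rewrite dis => /leqifP/eqP <-.
rewrite -cardZ; apply: leq_trans (card_extensions_le Z); apply: subset_leq_card.
by rewrite subUset subsetIr; apply/subsetP=> v; rewrite inE => /andP[].
Qed.

Lemma p_fact_le : 4 * (p * n`!%:R) <= (n - 2 * t)`!%:R.
Proof.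
have le_t : (t <= n - t)%N by move: t_small; clear; lia.
have w_le : w <= (n ^ t)%:R * (n - 2 * t)`!%:R.
  rewrite -natrM ler_nat -(ffact_fact le_t) -subnDA addnn -mul2n leq_mul2r.
  apply/orP; right; apply: leq_trans (leq_ffact_expn _ _) _.
  by rewrite leq_exp2r // leq_subr.
have N0 := natrX_gt0 t.
have h := le_trans fact_le_expn (ler_wpM2l (ltW N0) w_le).
have -> : (n ^ (3 * t))%:R = (n ^ t)%:R ^+ 3 :> R by rewrite -natrX -expnM mulnC.
have N4 : 4 <= (n ^ t)%:R :> R.
  rewrite ler_nat; apply: (@leq_trans n); first exact: leq_trans n_ge1000.
  by rewrite -[X in (X <= _)%N]expn1 leq_exp2l.
have v0 : 0 <= (n - 2 * t)`!%:R :> R by rewrite ler0n.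
move: N0 N4 h v0; move: (n ^ t)%:R n`!%:R (n - 2 * t)`!%:R => N m v N0 N4 h v0.
have N3 : 0 < N ^+ 3 by rewrite exprn_gt0.
rewrite mulrCA mulrC ler_pdivrMr //; apply: le_trans (ler_wpM2l (ler0n _ 4) h) _.
rewrite (_ : v * N ^+ 3 = N * (N * (N * v))); last by ring.
by rewrite ler_wpM2r // !mulr_ge0 // ltW.
Qed.

(** A loss of [r] in one factor outweighs gains of [r / 4] in both: the terms linear in [v] sum to
    [- v * r / 2]. *)
Lemma product_le_aux (v r f g : R) : 0 < r -> r <= v -> 0 <= f -> 0 <= g ->
    4 * f <= r -> 4 * g <= r ->
  (v + f) * (v - r + g) <= v ^+ 2.
Proof.
move=> r0 rv f0 g0 fr gr.
have h1 : (v + f) * (v - r + g) <= (v + r / 4) * (v - 3 / 4 * r).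
  by apply: ler_pM; lra.
apply: le_trans h1 _; have := mulr_ge0 (ltW r0) (ltW (lt_le_trans r0 rv)).
by have := sqr_ge0 r; lra.
Qed.

Lemma split_card_le F G Z : #|Z| = t -> avoids F G ->
    F :\: extensions Z != set0 ->
    w / 4 <= #|F :&: extensions Z|%:R -> w / 4 <= #|G :&: extensions Z|%:R ->
  #|F|%:R * #|G|%:R <= w ^+ 2 :> R.
Proof.
move=> cardZ avFG /set0Pn[s sF] leF leG.
have w0 : 0 < w by rewrite ltr0n fact_gt0.
have outF := card_outside avFG cardZ leG.
have outG := card_outside (avoidsC avFG) cardZ leF.
have inF := card_ext_le_w F cardZ.
have neG : G :&: extensions Z != set0.
  by rewrite -card_gt0 -(ltr_nat R); apply: lt_le_trans leG; lra.
have inG := card_inside avFG cardZ sF neG.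
have pm := p_fact_le.
rewrite -(cardsID (extensions Z) F) -(cardsID (extensions Z) G) !natrD.
have r0 : 0 < (n - 2 * t)`!%:R :> R by rewrite ltr0n fact_gt0.
have rw : (n - 2 * t)`!%:R <= w.
  by rewrite ler_nat leq_fact // leq_sub2l // leq_pmull.
have f0 := ler0n R #|F :\: extensions Z|; have g0 := ler0n R #|G :\: extensions Z|.
apply: le_trans (product_le_aux r0 rw f0 g0 _ _); try by lra.
by apply: ler_pM; rewrite ?addr_ge0 ?ler0n //; lra.
Qed.

(** If the bound failed, both families would have at least [w / 4] members above the center [Z]. A
    member outside [Z] in either family is excluded by [split_card_le], and without one both sizes
    are at most [w]. *)
Theorem avoids_card_le F G : avoids F G -> (#|F| * #|G| <= ((n - t)`!) ^ 2)%N.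
Proof.
move=> avFG; rewrite -(ler_nat R) natrM natrX leNgt; apply/negP=> gt_w.
have [Z cardZ leZ] := exists_center avFG.
have inF := card_ext_le_w F cardZ; have inG := card_ext_le_w G cardZ.
have w0 : 0 < w by rewrite ltr0n fact_gt0.
have prod : w * (w / 4) <= #|F :&: extensions Z|%:R * #|G :&: extensions Z|%:R.
  by move: leZ gt_w; clear; lra.
have leG : w / 4 <= #|G :&: extensions Z|%:R.
  rewrite -(ler_pM2l w0); apply: le_trans prod _.
  by rewrite ler_wpM2r ?ler0n.
have leF : w / 4 <= #|F :&: extensions Z|%:R.
  rewrite -(ler_pM2r w0) mulrC; apply: le_trans prod _.
  by rewrite ler_wpM2l ?ler0n.
have [F0|neF] := eqVneq (F :\: extensions Z) set0; last first.
  by have := split_card_le cardZ avFG neF leF leG; rewrite leNgt gt_w.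
have [G0|neG] := eqVneq (G :\: extensions Z) set0; last first.
  have := split_card_le cardZ (avoidsC avFG) neG leG leF.
  by rewrite mulrC leNgt gt_w.
move: gt_w; rewrite ltNge => /negP[].
rewrite -(cardsID (extensions Z) F) -(cardsID (extensions Z) G) F0 G0 !cards0 !addn0.
by apply: ler_pM; rewrite ?ler0n.
Qed.

End Main.

Theorem theorem1 (R : realType) :
  exists c : R, 0 < c /\
    forall n t : nat, (2 <= n)%N -> (1 <= t)%N ->
      t%:R <= c * (n%:R / ln n%:R) ->
      forall F G : {set 'S_n},
        (forall sigma tau : 'S_n, sigma \in F -> tau \in G ->
           #|agreement_set sigma tau| <> (t - 1)%N) ->
        (#|F| * #|G| <= ((n - t)`!) ^ 2)%N.
Proof.
have A1 : 1 < 11 / 10 :> R by lra.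
have A0 : 0 < 11 / 10 :> R by lra.
have lnA : 0 < ln (11 / 10 : R) by rewrite ln_gt0.
(* Taking logarithms in [A ^+ x <= n ^ (4 * t)] gives [x * ln A <= 4 * t * ln n <= 4 * c * n]; the
   factor 1000 required of [x] makes 4000. *)
exists (ln (11 / 10) / 4000); split; first by rewrite divr_gt0 ?ltr0n.
move=> n t n2 t1 le_t F G avFG.
apply: (@avoids_card_le R) => //; last first.
  by move=> s u sF uG; rewrite -card_agreement_set; apply: avFG.
have N1 : 1 < n%:R :> R by rewrite ltr1n.
have lnN : 0 < ln (n%:R : R) by rewrite ln_gt0.
have N0 : 0 < n%:R :> R by rewrite ltr0n ltnW.
rewrite mulrA ler_pdivlMr // in le_t.
move=> x le_x; rewrite -(ler_nat R) natrM.
have : ln ((11 / 10 : R) ^+ x) <= ln ((n ^ (4 * t))%:R : R).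
  by rewrite ler_ln // posrE ?exprn_gt0 // natrX exprn_gt0.
rewrite natrX !lnXn // -[leLHS]mulr_natr -[leRHS]mulr_natr natrM => le_ln.
rewrite -(ler_pM2l lnA); move: le_t le_ln; clear.
move: (ln (11 / 10 : R)) (ln (n%:R : R)) (x%:R : R) (n%:R : R) (t%:R : R) => a l x' N t' h1 h2; lra.
Qed.
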